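(* Let $\Omega\subset\mathbb{R}^N$ be an exterior domain and $\theta:\partial\Omega\to[0,1]$ a boundary function as in the context. Let $g:[0,\infty)\to(0,1]$ be a monotonically decreasing continuous function such that $\lim_{t\to\infty}g(t)=0$. Then there exist an initial value $0\leq u_0\in L^1(\Omega)$ with $\|u_0\|_{L^1(\Omega)}=1$ and $T>0$ such that $$\left\|S^\theta(t)u_0-m_{u_0}G(\cdot,t)\right\|_{L^1(\Omega)}\geq g(t)\qquad\text{for all } t>T,$$ where $m_{u_0}=\int_\Omega\Phi^\theta(x)u_0(x)\,dx$ and $G(x,t)=\frac{e^{-|x|^2/(4t)}}{(4\pi t)^{N/2}}$.
   Context: Setting. $\Omega=\mathbb{R}^N\setminus\mathcal{C}$ is connected, where the hole $\mathcal{C}$ is a compact set which is the closure of a bounded smooth open set, with $0$ in the interior of $\mathcal{C}$ and $\partial\Omega$ of class $C^{2,\alpha}$ for some $0<\alpha<1$ ($\mathcal{C}$ may have several connected components). The function $\theta:\partial\Omega\to[0,1]$ is of class $C^{1,\alpha}$ for some $0<\alpha<1$ and on each connected component of $\partial\Omega$ satisfies either $\theta\equiv 0$ (Dirichlet) or $0<\theta\leq 1$ (mixed Neumann and Robin; $\theta\equiv1$ is Neumann). The boundary operator is $B_\theta(u)=\sin(\frac{\pi}{2}\theta(x))\frac{\partial u}{\partial n}+\cos(\frac{\pi}{2}\theta(x))u$ on $\partial\Omega$, with $n$ the unit normal pointing out of $\Omega$. Semigroup. $S^\theta(t)$, $t>0$, is the heat semigroup in $\Omega$ with boundary condition $B_\theta(u)=0$: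 on $L^2(\Omega)$ it is generated by the Laplacian with domain $\{u\in W^{2,2}(\Omega): B_\theta(u)=0 \text{ on }\partial\Omega\}$. It has a positive symmetric integral kernel $k^\theta(x,y,t)$, and on $L^p(\Omega)$, $1\leq p\leq\infty$, it is the contraction semigroup given by $S^\theta(t)u_0(x)=\int_\Omega k^\theta(x,y,t)u_0(y)\,dy$. Asymptotic profile. $\Phi^\theta(x)=\lim_{t\to\infty}S^\theta(t)1_\Omega(x)$, $x\in\Omega$ (a monotonically decreasing limit, with $0\leq\Phi^\theta\leq 1$), where $1_\Omega$ is the constant function $1$ on $\Omega$. *)

(* Defs.v *)
From HB Require Import structures.
From mathcomp Require Import all_boot all_order all_algebra.
From mathcomp Require Import all_classical all_reals all_analysis.

Set Implicit Arguments.
Unset Strict Implicit.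
Unset Printing Implicit Defensive.
Import Order.TTheory GRing.Theory Num.Theory.
Import numFieldNormedType.Exports.

Local Open Scope classical_set_scope.
Local Open Scope ring_scope.

(** R^N is ['rV[R]_N].  Its library topology is that of the sup norm, which is
    the usual one; Euclidean lengths are given by [enorm]. *)

Definition enorm (R : realType) (N : nat) (x : 'rV[R]_N) : R :=
  Num.sqrt (\sum_(i < N) x ord0 i ^+ 2).

(** The sigma-algebra on R^N is generated by the coordinates; it is the Borel
    sigma-algebra. *)

Definition rV_display : measure_display. Proof. exact: default_measure_display. Qed.

Section measurable_rV.
Context (R : realType) (N : nat).

Let coord : 'I_N -> 'rV[R]_N -> R := fun i x => x ord0 i.

Let rV_set0 : g_sigma_preimage coord set0.
Proof. exact: sigma_algebra0. Qed.

Let rV_setC A : g_sigma_preimage coord A -> g_sigma_preimage coord (~` A).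
Proof. exact: sigma_algebraC. Qed.

Let rV_bigcup (F : (set 'rV[R]_N)^nat) :
  (forall i, g_sigma_preimage coord (F i)) ->
  g_sigma_preimage coord (\bigcup_i (F i)).
Proof. exact: sigma_algebra_bigcup. Qed.

HB.instance Definition _ := @isMeasurable.Build rV_display
  'rV[R]_N (g_sigma_preimage coord) rV_set0 rV_setC rV_bigcup.

Lemma measurable_rV_coord (i : 'I_N) :
  measurable_fun [set: 'rV[R]_N] (fun x : 'rV[R]_N => x ord0 i).
Proof.
move=> _ Y mY; rewrite setTI; apply: sub_sigma_algebra => /=.
rewrite -bigcup_seq/=; exists i => /=; first by rewrite mem_index_enum.
by exists Y => //; rewrite setTI.
Qed.

Lemma measurable_fun_rV d (T : measurableType d) (f : T -> 'rV[R]_N) :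
  (forall i, measurable_fun [set: T] (fun t => f t ord0 i)) ->
  measurable_fun [set: T] f.
Proof.
move=> mf; suff H : g_sigma_preimage (fun i => coord i \o f) `<=` measurable.
  move=> _ A mA; apply: H; rewrite g_sigma_preimage_comp.
  by exists A.
apply: smallest_sub; first exact: sigma_algebra_measurable.
rewrite -bigcup_seq; apply: bigcup_sub => i _ A [B mB <-]; exact: mf.
Qed.

End measurable_rV.

Definition cons_rV (R : realType) (N : nat) (p : R * 'rV[R]_N) : 'rV[R]_N.+1 :=
  \row_i oapp (p.2 ord0) p.1 (unlift ord0 i).

Lemma measurable_cons_rV (R : realType) (N : nat) :
  measurable_fun [set: R * 'rV[R]_N] (@cons_rV R N).
Proof.
apply: measurable_fun_rV => i; rewrite /cons_rV.
under eq_fun do rewrite mxE.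
case: unliftP => [j|] _ /=; last exact: measurable_fst.
exact: (measurableT_comp (@measurable_rV_coord R N j) measurable_snd).
Qed.

Section lebesgue_rV.
Context (R : realType).

(** [lebesgue_cons mu] is the product of the Lebesgue measure of the line with
    the measure [mu] on R^N, carried over to R^(N+1). *)

Definition lebesgue_cons N (mu : {measure set 'rV[R]_N -> \bar R}) :
    set 'rV[R]_N.+1 -> \bar R :=
  pushforward (@lebesgue_measure R \x^ mu)%E (@cons_rV R N).

Section lebesgue_cons_measure.
Context (N : nat) (mu : {measure set 'rV[R]_N -> \bar R}).

Let mf := @measurable_cons_rV R N.

Let lebesgue_cons0 : lebesgue_cons mu set0 = 0%E.
Proof. by rewrite /lebesgue_cons measure0. Qed.

Let lebesgue_cons_ge0 A : (0 <= lebesgue_cons mu A)%E.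
Proof. rewrite /lebesgue_cons; exact: measure_ge0. Qed.

Let lebesgue_cons_sigma_additive : semi_sigma_additive (lebesgue_cons mu).
Proof. rewrite /lebesgue_cons; exact: measure_semi_sigma_additive. Qed.

HB.instance Definition _ := isMeasure.Build _ _ _ (lebesgue_cons mu)
  lebesgue_cons0 lebesgue_cons_ge0 lebesgue_cons_sigma_additive.

End lebesgue_cons_measure.

Fixpoint lebesgue_rV (N : nat) : {measure set 'rV[R]_N -> \bar R} :=
  match N with
  | 0 => dirac (0 : 'rV[R]_0)
  | N'.+1 => lebesgue_cons (lebesgue_rV N')
  end.

End lebesgue_rV.

(** Hausdorff measure of dimension [s] on R^N for the Euclidean distance, up to
    the usual normalizing constant.  For [s = N - 1] it is a positive multiple
    of the surface measure on C^1 hypersurfaces; it is used below only through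
    null sets and L^2 convergence, where the multiple is irrelevant. *)

Section hausdorff.
Context (R : realType) (N : nat).
Local Open Scope ereal_scope.

Definition diam (A : set 'rV[R]_N) : \bar R :=
  ereal_sup [set (enorm (z.1 - z.2)%R)%:E | z in A `*` A].

Definition hausdorff_gauge (s : nat) (d : R) (A : set 'rV[R]_N) : \bar R :=
  if `[< A = set0 >] then 0
  else if diam A <= d%:E then diam A ^+ s else +oo.

(** Infimum of [\sum_k diam (A_k) ^ s] over countable covers by Borel sets of
    diameter at most [d]; restricting to Borel sets changes nothing since a set
    and its closure have the same diameter. *)
Definition hausdorff_pre (s : nat) (d : R) : set 'rV[R]_N -> \bar R :=
  mu_ext (hausdorff_gauge s d).

Definition hausdorff (s : nat) (A : set 'rV[R]_N) : \bar R :=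
  ereal_sup [set hausdorff_pre s d A | d in [set d : R | (0 < d)%R]].

Lemma hausdorff_gauge0 s d : hausdorff_gauge s d set0 = 0.
Proof. by rewrite /hausdorff_gauge; case: asboolP. Qed.

Lemma hausdorff_gauge_ge0 s d A : 0 <= hausdorff_gauge s d A.
Proof.
rewrite /hausdorff_gauge; case: asboolP => // /eqP/set0P[x Ax].
case: ifPn => // _; apply: expe_ge0; apply: le_ereal_sup_tmp.
by exists (enorm (x - x))%:E; [exists (x, x)|rewrite lee_fin sqrtr_ge0].
Qed.

Section hausdorff_outer_measure.
Context (s : nat).

Let gauge0 d := hausdorff_gauge0 s d.
Let gauge_ge0 d := hausdorff_gauge_ge0 s d.

Let hausdorff_ge0 A : 0 <= hausdorff s A.
Proof.
apply: le_ereal_sup_tmp; exists (hausdorff_pre s 1 A).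
  by exists 1%R => //=.
exact: mu_ext_ge0.
Qed.

Let hausdorff0 : hausdorff s set0 = 0.
Proof.
apply/eqP; rewrite eq_le hausdorff_ge0 andbT.
by apply: ge_ereal_sup => _ [d _ <-]; rewrite /hausdorff_pre mu_ext0.
Qed.

Let le_hausdorff : {homo hausdorff s : A B / A `<=` B >-> A <= B}.
Proof.
move=> A B AB; apply: ge_ereal_sup => _ [d d0 <-].
apply: le_ereal_sup_tmp; exists (hausdorff_pre s d B); first by exists d.
exact: le_mu_ext.
Qed.

Let hausdorff_sigma_subadditive : sigma_subadditive (hausdorff s).
Proof.
move=> F; apply: ge_ereal_sup => _ [d d0 <-].
apply: (le_trans (mu_ext_sigma_subadditive (@gauge_ge0 d) F)).
apply: lee_nneseries => [i _ _|i _]; first exact: mu_ext_ge0.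
by rewrite /hausdorff; apply: ereal_sup_ubound; exists d.
Qed.

HB.instance Definition _ := isOuterMeasure.Build R 'rV[R]_N (hausdorff s)
  hausdorff0 hausdorff_ge0 le_hausdorff hausdorff_sigma_subadditive.

End hausdorff_outer_measure.

End hausdorff.

Definition surface_outer (R : realType) (N : nat) :
    {outer_measure set 'rV[R]_N -> \bar R} := @hausdorff R N N.-1.

Definition surface (R : realType) (N : nat) :
    {measure set (caratheodory_type (@surface_outer R N)) -> \bar R} :=
  (@surface_outer R N : set (caratheodory_type (@surface_outer R N)) -> \bar R).

Section smoothness.
Context (R : realType) (N : nat).
Implicit Types (f : 'rV[R]_N -> R) (W A : set 'rV[R]_N) (x : 'rV[R]_N).

Definition boundary A : set 'rV[R]_N := closure A `\` A°.

Definition partial (i : 'I_N) f : 'rV[R]_N -> R :=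
  fun x => 'D_(delta_mx ord0 i) f x.

Definition partials (l : seq 'I_N) f : 'rV[R]_N -> R := foldr partial f l.

Definition grad f x : 'rV[R]_N := \row_i partial i f x.

(** [W] is meant to be open in the next two definitions. *)

Definition class_C (k : nat) W f : Prop :=
  forall l : seq 'I_N, (size l <= k)%N ->
    (forall x, W x -> {for x, continuous (partials l f)}) /\
    ((size l < k)%N -> forall i x, W x ->
       derivable (partials l f) x (delta_mx ord0 i)).

Definition class_CH (k : nat) (a : R) W f : Prop :=
  class_C k W f /\
  exists K : R, forall l : seq 'I_N, size l = k -> forall x y, W x -> W y ->
    `|partials l f x - partials l f y| <= K * enorm (x - y) `^ a.

(** The boundary of the open set [A] is of class C^{k,a}: near each of its
    points [A] is the sublevel set of a C^{k,a} function with nonvanishing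
    gradient. *)
Definition CH_boundary (k : nat) (a : R) A : Prop :=
  forall x0, boundary A x0 ->
    exists (W : set 'rV[R]_N) (rho : 'rV[R]_N -> R),
      [/\ open W, W x0, class_CH k a W rho,
          forall x, W x -> grad rho x != 0 &
          forall x, W x -> (A x <-> rho x < 0)].

Definition outward_normal A x (n : 'rV[R]_N) : Prop :=
  exists (W : set 'rV[R]_N) (rho : 'rV[R]_N -> R),
    [/\ open W, W x, class_C 1 W rho /\ grad rho x != 0,
        forall y, W y -> (A y <-> rho y < 0) &
        n = (enorm (grad rho x))^-1 *: grad rho x].

(** A function on [A] of class C^{k,a}: locally the restriction of a C^{k,a}
    function of R^N. *)
Definition CH_on (k : nat) (a : R) A f : Prop :=
  forall x0, A x0 ->
    exists (W : set 'rV[R]_N) (h : 'rV[R]_N -> R),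
      [/\ open W, W x0, class_CH k a W h &
          forall x, W x -> A x -> f x = h x].

End smoothness.

Section exterior_problem.
Context (R : realType) (N : nat).
Local Notation V := 'rV[R]_N.
Local Notation leb := (@lebesgue_rV R N).
Implicit Types (Omega : set V) (u f : V -> R).

Definition is_hole (C : set V) : Prop :=
  [/\ compact C, C° 0, connected (~` C) &
      exists a : R, [/\ 0 < a < 1, CH_boundary 2 a (~` C) &
        exists U : set V, [/\ open U, bounded_set U, CH_boundary 2 a U &
          C = closure U]]].

Definition is_boundary_function Omega (theta : V -> R) : Prop :=
  [/\ forall x, boundary Omega x -> 0 <= theta x <= 1,
      exists2 a : R, 0 < a < 1 & CH_on 1 a (boundary Omega) theta &
      forall x, boundary Omega x ->
        let K := connected_component (boundary Omega) x in
        (forall y, K y -> theta y = 0) \/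
        (forall y, K y -> 0 < theta y <= 1)].

Definition Lp_norm Omega (p : \bar R) u : \bar R :=
  'N[leb]_p [(EFin \o u) \_ Omega].

Definition in_Lp Omega (p : \bar R) u : Prop :=
  measurable_fun Omega u /\ (Lp_norm Omega p u < +oo)%E.

Definition test_function Omega u : Prop :=
  (forall k, class_C k setT u) /\
  exists K : set V, [/\ compact K, K `<=` Omega & forall x, ~ K x -> u x = 0].

Definition weak_partial Omega (i : 'I_N) u (v : V -> R) : Prop :=
  forall phi, test_function Omega phi ->
    (\int[leb]_(x in Omega) (u x * partial i phi x)) =
    - (\int[leb]_(x in Omega) (v x * phi x)).

(** [u] is in W^{1,2} with weak gradient [p] *)
Definition in_W12 Omega u (p : 'I_N -> V -> R) : Prop :=
  in_Lp Omega 2%:E u /\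
  forall i, in_Lp Omega 2%:E (p i) /\ weak_partial Omega i u (p i).

(** [u] is in W^{2,2} with weak gradient [p] and weak Hessian [q] *)
Definition in_W22 Omega u (p : 'I_N -> V -> R) (q : 'I_N -> 'I_N -> V -> R) :
    Prop :=
  in_W12 Omega u p /\ forall i, in_W12 Omega (p i) (q i).

(** [h] is the trace on the boundary of [u], a W^{1,2} function with weak
    gradient [p]: the trace operator is the continuous extension from W^{1,2}
    to L^2 of the boundary of the restriction of C^1 functions. *)
Definition is_trace Omega u (p : 'I_N -> V -> R) (h : V -> R) : Prop :=
  measurable_fun (boundary Omega : set (caratheodory_type (@surface_outer R N)))
    (h : caratheodory_type (@surface_outer R N) -> R) /\
  exists v : nat -> V -> R,
    [/\ forall n, class_C 1 setT (v n) /\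
          in_W12 Omega (v n) (fun i => partial i (v n)),
        Lp_norm Omega 2%:E (v n \- u) @[n --> \oo] --> 0%E,
        forall i,
          Lp_norm Omega 2%:E (partial i (v n) \- p i) @[n --> \oo] --> 0%E &
        (\int[@surface R N]_(x in boundary Omega) ((v n x - h x) ^+ 2)%:E)%E
          @[n --> \oo] --> 0%E].

(** The condition B_theta(u) = 0 on the boundary, for [u] in W^{2,2} with weak
    gradient [p] and weak Hessian [q]. *)
Definition boundary_condition Omega (theta : V -> R) u
    (p : 'I_N -> V -> R) (q : 'I_N -> 'I_N -> V -> R) : Prop :=
  exists (h : V -> R) (dh : 'I_N -> V -> R),
    [/\ is_trace Omega u p h, forall i, is_trace Omega (p i) (q i) (dh i) &
      {ae @surface R N, forall x, boundary Omega x ->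
        forall n, outward_normal Omega x n ->
          sin (pi / 2 * theta x) * (\sum_i dh i x * n ord0 i) +
          cos (pi / 2 * theta x) * h x = 0}].

(** Graph of the Laplacian in L^2 with domain
    {u in W^{2,2} : B_theta(u) = 0}. *)
Definition laplacian Omega (theta : V -> R) u f : Prop :=
  exists (p : 'I_N -> V -> R) (q : 'I_N -> 'I_N -> V -> R),
    [/\ in_W22 Omega u p q, boundary_condition Omega theta u p q &
      {ae leb, forall x, Omega x -> f x = \sum_i q i i x}].

(** [S], restricted to positive times, is the C_0-semigroup in L^2 whose
    generator has graph [A]. *)
Definition generated_by Omega (A : (V -> R) -> (V -> R) -> Prop)
    (S : R -> (V -> R) -> V -> R) : Prop :=
  [/\ forall t u, 0 < t -> in_Lp Omega 2%:E u -> in_Lp Omega 2%:E (S t u),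
      forall s t u, 0 < s -> 0 < t -> in_Lp Omega 2%:E u ->
        {ae leb, forall x, Omega x -> S (s + t) u x = S s (S t u) x},
      forall u, in_Lp Omega 2%:E u ->
        Lp_norm Omega 2%:E (S t u \- u) @[t --> 0^'+] --> 0%E &
      forall u f, in_Lp Omega 2%:E u -> in_Lp Omega 2%:E f ->
        (Lp_norm Omega 2%:E (fun x => (S t u x - u x) / t - f x)
           @[t --> 0^'+] --> 0%E <-> A u f)].

Definition heat_op Omega (k : V -> V -> R -> R) (t : R) u : V -> R :=
  fun x => \int[leb]_(y in Omega) (k x y t * u y).

Record is_heat_kernel Omega (theta : V -> R) (k : V -> V -> R -> R) : Prop := {
  heat_kernel_measurable : forall t, 0 < t ->
    measurable_fun (Omega `*` Omega) (fun z : V * V => k z.1 z.2 t) ;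
  heat_kernel_gt0 : forall x y t, Omega x -> Omega y -> 0 < t -> 0 < k x y t ;
  heat_kernel_sym : forall x y t, Omega x -> Omega y -> 0 < t ->
    k x y t = k y x t ;
  heat_kernel_generated :
    generated_by Omega (laplacian Omega theta) (heat_op Omega k) ;
  (* the integrals defining S(t)u converge absolutely *)
  heat_kernel_integrable : forall p u t, (1 <= p)%E -> in_Lp Omega p u ->
    0 < t -> {ae leb, forall x, Omega x ->
      leb.-integrable Omega (fun y => (k x y t * u y)%:E)} ;
  heat_kernel_semigroup : forall p u s t, (1 <= p)%E -> in_Lp Omega p u ->
    0 < s -> 0 < t -> {ae leb, forall x, Omega x ->
      heat_op Omega k (s + t) u x = heat_op Omega k s (heat_op Omega k t u) x} ;
  heat_kernel_contraction : forall p u t, (1 <= p)%E -> in_Lp Omega p u ->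
    0 < t -> in_Lp Omega p (heat_op Omega k t u) /\
      (Lp_norm Omega p (heat_op Omega k t u) <= Lp_norm Omega p u)%E }.

Definition asymptotic_profile Omega (k : V -> V -> R -> R) (Phi : V -> R) :
    Prop :=
  forall x, Omega x -> heat_op Omega k t (cst 1) x @[t --> +oo] --> Phi x.

Definition asymptotic_mass Omega (Phi u0 : V -> R) : R :=
  \int[leb]_(x in Omega) (Phi x * u0 x).

Definition gaussian (x : V) (t : R) : R :=
  expR (- (enorm x ^+ 2 / (4 * t))) / (4 * pi * t) `^ (N%:R / 2).

End exterior_problem.

(* Main.v *)
Require Import Defs.
From HB Require Import structures.
From mathcomp Require Import all_boot all_order all_algebra.
From mathcomp Require Import all_classical all_reals all_analysis.
From mathcomp Require Import measurable_realfun.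

From mathcomp Require Import ring lra.

Set Implicit Arguments.
Unset Strict Implicit.
Unset Printing Implicit Defensive.
Import Order.TTheory GRing.Theory Num.Theory.
Import numFieldNormedType.Exports.

Local Open Scope classical_set_scope.
Local Open Scope ring_scope.

(** Mass started far from the hole stays there for a long time, whereas the
    Gaussian is centred at the origin.  Let u be a C^2 bump of width r supported
    in a cube E of Omega.  It vanishes near the boundary, hence lies in the
    domain of the generator for every boundary condition, and
    ||S(t)u - u||_2 <= 2t ||Laplacian u||_2, which is O(t / r^2) ||u||_2.  If
    r^2 is large compared with tau, it follows that S(t)u keeps a fixed fraction
    c0 of the mass of u inside E for all t <= tau.  Moving E away from the origin
    makes the integral of G(., t) over E as small as desired for 1 <= t <= tau.

    Take u0 = \sum_n 2^-(n+1) w_n with w_n such a bump normalized in L^1, chosen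
    for a time s_(n+1), where g <= 2^-(n+2) c0 on [s_n, +oo[.  For t between s_n
    and s_(n+1), the n-th cube alone contributes at least 2^-(n+1) c0 minus a
    small Gaussian error, hence at least g(t), to the L^1 norm. *)

(** * Lebesgue measure on R^N *)

Section euclidean_measure.
Context (R : realType).

Lemma measurable_rV_box N (B : 'I_N -> set R) :
  (forall i, measurable (B i)) ->
  measurable [set x : 'rV[R]_N | forall i, B i (x ord0 i)].
Proof.
move=> mB.
rewrite (_ : [set _ | _] =
    \bigcap_(i in [set: 'I_N]) (fun x : 'rV[R]_N => x ord0 i) @^-1` B i).
  apply: fin_bigcap_measurable => // i _.
  by rewrite -[_ @^-1` _]setTI; exact: measurable_rV_coord.
by apply/seteqP; split => x /= Bx i; [move=> _|]; exact: Bx.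
Qed.

(** The sigma-algebra is generated by coordinates, so [A] has to be written with countably many
    coordinate boxes. The boxes with rational centre and half-side 1/(n+1) that lie inside [A] cover
    it. *)
Lemma open_measurable_rV N (A : set 'rV[R]_N) : open A -> measurable A.
Proof.
move=> oA.
pose box (p : 'rV[rat]_N * nat) : set 'rV[R]_N :=
  [set x | forall i, `]ratr (p.1 ord0 i) - p.2.+1%:R^-1,
                       ratr (p.1 ord0 i) + p.2.+1%:R^-1[%classic (x ord0 i)].
rewrite (_ : A = \bigcup_p (if `[< box p `<=` A >] then box p else set0)).
  apply: countable_bigcupT_measurable => [|p]; first exact: countableP.
  by case: ifP => // _; 
    apply: (measurable_rV_box (B := fun i => `]ratr (p.1 ord0 i) - p.2.+1%:R^-1,
      ratr (p.1 ord0 i) + p.2.+1%:R^-1[%classic)) => i; exact: measurable_itv.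
apply/seteqP; split => [x Ax|x [p _]]; last by case: asboolP => // + ?; apply.
have /nbhs_ballP[e /= e0 eA] : nbhs x A by apply: open_nbhs_nbhs.
(* Half of [e], because the box half-side is spent twice: from [x] to the rational centre, and from
   there to any other point of the box. *)
have [n ne] : exists n : nat, n.+1%:R^-1 < e / 2.
  have := near_infty_natSinv_lt (PosNum (divr_gt0 e0 (ltr0n R 2))).
  by move=> [n _ /(_ n)] /= h; exists n; exact: h.
have hn : 0 < n.+1%:R^-1 :> R by rewrite invr_gt0.
have /choice[q hq] i :
    exists q : rat, `|x ord0 i - ratr q| < n.+1%:R^-1.
  have : x ord0 i - n.+1%:R^-1 < x ord0 i + n.+1%:R^-1.
    by rewrite ltrD2l (lt_trans _ hn)// oppr_lt0.
  move=> /rat_in_itvoo[q]; rewrite in_itv /= => /andP[q1 q2].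
  by exists q; rewrite ltr_distlC q1 q2.
exists (\row_i q i, n) => //; case: asboolP => [_|[]].
  move=> i /=; rewrite in_itv /= mxE -ltr_distl.
  exact: hq.
move=> y /= hy; apply: eA; split=> // i j; rewrite (ord1 i) /ball /=.
have := hy j; rewrite /= in_itv /= mxE -ltr_distl => hyj.
rewrite (le_lt_trans (ler_distD (ratr (q j)) _ _))//.
rewrite [ltRHS](splitr e) ltrD// (lt_trans _ ne)//.
by rewrite distrC.
Qed.

Lemma continuous_measurable_rV N (f : 'rV[R]_N -> R) :
  continuous f -> measurable_fun [set: 'rV[R]_N] f.
Proof.
move/continuousP=> cf.
apply: (measurability _ (RGenOpens.measurableE R)).
move=> _ [_ [a [b ->] <-]]; rewrite setTI; apply: open_measurable_rV.
exact/cf/interval_open.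
Qed.

(** The pushforward under the translation gives half-open intervals their length, so it is Lebesgue
    measure by uniqueness. *)
Lemma lebesgue_measure_translation (c : R) (A : set R) : measurable A ->
  lebesgue_measure ((fun x : R => x + c) @^-1` A) = lebesgue_measure A.
Proof.
have mc : measurable_fun [set: measurableTypeR R]
    ((fun x : R => x + c) : measurableTypeR R -> measurableTypeR R).
  by apply: measurable_funD; [exact: measurable_id|exact: measurable_cst].
pose mu := [the {measure set (measurableTypeR R) -> \bar R} of
  pushforward (@lebesgue_measure R)
    ((fun x : R => x + c) : measurableTypeR R -> measurableTypeR R)].
move=> mA; apply/esym; apply: (@lebesgue_measure_unique R (mu mc)) => // {A mA}.
move=> _ [[a b] /= _ <-].
rewrite /mu /= /pushforward.
rewrite (_ : _ @^-1` _ = `]a - c, b - c]%classic); last first.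
  by apply/seteqP; split => x /=; rewrite !in_itv /= ltrBlDr lerBrDr.
rewrite !lebesgue_measure_itv /= !lte_fin ltrD2r; case: ifP => // _.
by rewrite -!EFinB opprB addrA subrK.
Qed.

Lemma measurable_add_rV N (v : 'rV[R]_N) :
  measurable_fun [set: 'rV[R]_N] (fun x => x + v).
Proof.
apply: measurable_fun_rV => i; under eq_fun do rewrite mxE.
apply: measurable_funD => //; exact: measurable_rV_coord.
Qed.

(** Induction on the dimension. The measure integrates the lengths of one-dimensional sections. The
    first coordinate of [v] shifts each section, which leaves its length unchanged; the other
    coordinates shift the variable of integration, and the induction hypothesis serves as the change
    of variables. *)
Lemma lebesgue_rV_translation N (v : 'rV[R]_N) (A : set 'rV[R]_N) :
  measurable A ->
  lebesgue_rV R N ((fun x => x + v) @^-1` A) = lebesgue_rV R N A.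
Proof.
elim: N v A => [|N IH] v A mA.
  rewrite (_ : _ @^-1` _ = A)//.
  by apply/seteqP; split => x /=; rewrite [x + v]thinmx0 [x]thinmx0.
rewrite /= /lebesgue_cons /pushforward.
have mc : measurable ((fun x => x + v) @^-1` A).
  by rewrite -[_ @^-1` _]setTI; exact: measurable_add_rV.
pose c := @cons_rV R N.
have mcA : measurable (c @^-1` A).
  by rewrite -[_ @^-1` _]setTI; exact: measurable_cons_rV.
pose v' : 'rV[R]_N := \row_i v ord0 (lift ord0 i).
pose G (y : 'rV[R]_N) := lebesgue_measure (ysection (c @^-1` A) y).
have mG : measurable_fun setT G by exact: measurable_fun_ysection.
have cD x y : c (x, y) + v = c (x + v ord0 ord0, y + v').
  apply/rowP => i; rewrite !mxE; case: unliftP => [j|] -> //=.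
  by rewrite !mxE.
transitivity (\int[lebesgue_rV R N]_y G (y + v')%R)%E.
  apply: eq_integral => y _; rewrite /G.
  rewrite -(lebesgue_measure_translation (v ord0 ord0)); last first.
    exact: measurable_ysection.
  congr (lebesgue_measure _); apply/seteqP; split=> x /=;
    rewrite /ysection /= !inE /=.
    by rewrite -/c cD.
  by rewrite -cD.
rewrite -[LHS](ge0_integral_pushforward (measurable_add_rV v')
  (lebesgue_rV R N) measurableT mG); last first.
  by move=> y _; exact: measure_ge0.
apply: eq_measure_integral => [|mf B mB _]; [exact: measurable_add_rV|exact: IH].
Qed.

Definition cube N (a : 'rV[R]_N) (r : R) : set 'rV[R]_N :=
  [set x | forall i, `|x ord0 i - a ord0 i| <= r].

Lemma measurable_cube N (a : 'rV[R]_N) r : measurable (cube a r).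
Proof.
rewrite (_ : cube a r = [set x | forall i,
    `[a ord0 i - r, a ord0 i + r]%classic (x ord0 i)]).
  apply: (measurable_rV_box (B := fun i => `[a ord0 i - r, a ord0 i + r]%classic)).
  by move=> i; exact: measurable_itv.
by apply/seteqP; split=> x /= h i; have := h i; rewrite /= in_itv /= ler_distl.
Qed.

Lemma lebesgue_rV_cube N (a : 'rV[R]_N) r : 0 <= r ->
  lebesgue_rV R N (cube a r) = ((r *+ 2) ^+ N)%:E.
Proof.
move=> r0; elim: N a => [|N IH] a.
  by rewrite /= expr0 diracE mem_set// => -[].
rewrite /= /lebesgue_cons /pushforward /=.
set c := @cons_rV R N.
rewrite (_ : _ @^-1` _ = `[a ord0 ord0 - r, a ord0 ord0 + r]%classic `*`
    cube (\row_i a ord0 (lift ord0 i)) r); last first.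
  apply/seteqP; split => [[x y]|[x y]] /=.
    move=> h; split; first by have := h ord0; rewrite in_itv /= mxE unlift_none /= ler_distl.
    by move=> i; have := h (lift ord0 i); rewrite !mxE liftK.
  rewrite in_itv /= => -[h1 h2] i; rewrite mxE; case: unliftP => [j|] ->/=.
    by have := h2 j; rewrite mxE.
  by rewrite ler_distl.
have mI : measurable (`[a ord0 ord0 - r, a ord0 ord0 + r]%classic : set R) by exact: measurable_itv.
rewrite product_measure2E //; last exact: measurable_cube.
rewrite IH exprS EFinM; congr (_ * _)%E.
apply: etrans (lebesgue_measure_itv _) _; rewrite /= lte_fin.
case: ifPn => [_|].
  by rewrite -EFinB; congr EFin; ring.
(* The interval formula returns 0 unless the left end is strictly below the right one, which here
   leaves only r = 0. *)
rewrite -leNgt => h; have -> : r = 0 by apply/eqP; rewrite eq_le r0 andbT; lra.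
by rewrite mul0rn.
Qed.

End euclidean_measure.

(** * Integration by parts against compactly supported functions *)

Section divergence.
Context (R : realType) (N : nat).
Local Notation V := 'rV[R]_N.
Local Notation leb := (lebesgue_rV R N).
Implicit Types (f w u du phi : V -> R) (a x v : V) (r : R).

Lemma compact_cube a r : compact (cube a r).
Proof.
rewrite (_ : cube a r = [set x | forall i,
    `[a ord0 i - r, a ord0 i + r]%classic (x ord0 i)]).
  apply: (rV_compact (A := fun i => `[a ord0 i - r, a ord0 i + r]%classic)).
  by move=> i; exact: segment_compact.
by apply/seteqP; split=> x /= h i; have := h i; rewrite /= in_itv /= ler_distl.
Qed.

Lemma continuous_vanish_bounded f a r : continuous f ->
  (forall x, ~ cube a r x -> f x = 0) ->
  exists2 M, 0 <= M & forall x, `|f x| <= M.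
Proof.
move=> cf f0.
have : bounded_set (f @` cube a r).
  apply: compact_bounded; apply: continuous_compact; last exact: compact_cube.
  exact: continuous_subspaceT.
(* Boundedness only provides bounds strictly above [M], hence the added 1; the absolute value makes
   the bound nonnegative. *)
move=> [M [_ /(_ (`|M| + 1))]].
rewrite (le_lt_trans (ler_norm _)) ?ltrDl// => /(_ isT) /= hM.
exists (`|M| + 1) => [|x]; first by rewrite addr_ge0.
have [xc|xc] := pselect (cube a r x); first by apply: hM; exists x.
by rewrite f0// normr0 addr_ge0.
Qed.

(** The majorant for bounded functions supported in a cube, used for integrability and for dominated
    convergence. *)
Lemma integrable_cst_cube a r (M : R) : 0 <= r ->
  leb.-integrable setT (EFin \o (M \o* \1_(cube a r))).
Proof.
move=> r0; rewrite (_ : EFin \o _ =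
    (fun x => (EFin \o \1_(cube a r)) x * M%:E)%E); last exact/funext.
apply: integrableZr => //.
have mc := measurable_cube a r.
apply/integrableP; split; first by apply/measurable_EFinP; exact: measurable_indic.
rewrite (eq_integral (fun x => (\1_(cube a r) x)%:E)); last first.
  by move=> x _; rewrite /= ger0_norm// indicE.
by rewrite integral_indic// setIT lebesgue_rV_cube// ltry.
Qed.

Lemma bounded_vanish_integrable f a r (M : R) : 0 <= r ->
  measurable_fun setT f ->
  (forall x, `|f x| <= M) -> (forall x, ~ cube a r x -> f x = 0) ->
  leb.-integrable setT (EFin \o f).
Proof.
move=> r0 mf fM f0.
apply: (le_integrable _ _ _ (integrable_cst_cube a M r0)) => //.
  exact/measurable_EFinP.
move=> x _ /=; rewrite lee_fin indicE.
have [xc|xc] := pselect (cube a r x).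
  by rewrite mem_set//= mul1r (le_trans (fM x))// ler_norm.
by rewrite f0// normr0.
Qed.

Lemma continuous_vanish_integrable f a r : 0 <= r -> continuous f ->
  (forall x, ~ cube a r x -> f x = 0) ->
  leb.-integrable setT (EFin \o f).
Proof.
move=> r0 cf f0; have [M _ fM] := continuous_vanish_bounded cf f0.
apply: (bounded_vanish_integrable r0 _ fM f0).
exact: continuous_measurable_rV.
Qed.

Lemma Rintegral_translation f v : leb.-integrable setT (EFin \o f) ->
  leb.-integrable setT (EFin \o (fun x => f (x + v))) ->
  \int[leb]_x f (x + v) = \int[leb]_x f x.
Proof.
move=> fi fvi; congr fine; rewrite -[LHS](integral_pushforward
  (measurable_add_rV v) (measurable_int _ fi) fvi measurableT).
by apply: eq_measure_integral => [|mf B mB _];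
  [exact: measurable_add_rV|exact: lebesgue_rV_translation].
Qed.

(** Both derivatives are limits of the same difference quotients. Passing to the line makes the
    one-variable mean value theorem and chain rule available; [is_derive_lineV] goes back. *)
Lemma is_derive_line f df v x (s : R) : is_derive (x + s *: v) v f df ->
  is_derive s 1 (fun s : R => f (x + s *: v)) df.
Proof.
move=> [fd fv].
have E : (fun h : R => h^-1 *: (((fun s : R => f (x + s *: v)) \o shift s) (h *: 1) -
    f (x + s *: v))) =
    (fun h : R => h^-1 *: ((f \o shift (x + s *: v)) (h *: v) - f (x + s *: v))).
  apply/funext => h /=; congr (_ *: (f _ - _)).
  by rewrite [h%:A]mulr1 scalerDl addrCA.
by split; [rewrite /derivable E|rewrite -fv /derive E].
Qed.

(** By translation invariance every difference quotient of [w] along [v] has integral 0. The mean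
    value theorem bounds the quotients by the supremum of [dw], so dominated convergence passes the
    integral to the limit [dw]. *)
Lemma Rintegral_partial0 w dw v a r : 0 <= r -> 
  (forall x, is_derive x v w (dw x)) -> continuous w -> continuous dw ->
  (forall i, `|v ord0 i| <= 1) ->
  (forall x, ~ cube a r x -> w x = 0) -> (forall x, ~ cube a r x -> dw x = 0) ->
  \int[leb]_x dw x = 0.
Proof.
move=> r0 wd cw cdw v1 w0 dw0.
have [M M0 dwM] := continuous_vanish_bounded cdw dw0.
pose h n : R := n.+1%:R^-1.
have h0 n : 0 < h n by rewrite invr_gt0.
have h1 n : h n <= 1 by rewrite invf_le1// ler1n.
pose f n x := (h n)^-1 * (w (x + h n *: v) - w x).
have cwh n : continuous (fun x => w (x + h n *: v)).
  move=> x; apply: (@continuous_comp _ _ _ (fun x => x + h n *: v) w); last exact: cw.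
  by apply: (@cvgD R V V (nbhs x) _ idfun (cst (h n *: v))); [exact: cvg_id|exact: cvg_cst].
(* Steps of length at most 1 along a direction with coordinates at most 1 enlarge the supporting
   cube by at most 1, uniformly in [n]. *)
have wh0 n x : ~ cube a (r + 1) x -> w (x + h n *: v) = 0.
  move=> xc; apply: w0; apply: contra_not xc => xc i.
  rewrite -[x ord0 i](addrK (h n * v ord0 i)) addrAC.
  rewrite (le_trans (ler_normB _ _))// lerD//.
    by have := xc i; rewrite !mxE.
  rewrite normrM (gtr0_norm (h0 n)) -[leRHS]mul1r.
  by apply: ler_pM => //; exact: ltW.
have iw : leb.-integrable setT (EFin \o w) by exact: continuous_vanish_integrable r0 cw w0.
have iwh n : leb.-integrable setT (EFin \o (fun x => w (x + h n *: v))).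
  by apply: (continuous_vanish_integrable _ (cwh n) (wh0 n)); rewrite addr_ge0.
have If n : \int[leb]_x f n x = 0.
  rewrite RintegralZl//; last exact: (integrableB measurableT (iwh n) iw).
  by rewrite (RintegralB measurableT (iwh n) iw) (Rintegral_translation iw (iwh n)) subrr mulr0.
have fM n x : `|f n x| <= M.
  have cl : continuous (fun s : R => w (x + s *: v)).
    move=> s; apply: (@continuous_comp _ _ _ (fun s : R => x + s *: v) w).
      by apply: cvgD; [exact: cvg_cst|exact: scalel_continuous].
    exact: cw.
  have [||c _] := @MVT_segment R (fun s => w (x + s *: v))
      (fun s => dw (x + s *: v)) 0 (h n) (ltW (h0 n)).
  - by move=> s _; exact: is_derive_line.
  - exact: continuous_subspaceT.
  rewrite scale0r addr0 subr0 /f => ->.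
  by rewrite mulrCA mulVf ?gt_eqF// mulr1.
have mf n : measurable_fun setT (f n).
  apply: measurable_funM => //; apply: measurable_funB;
    exact: continuous_measurable_rV.
have f0 n x : ~ cube a (r + 1) x -> f n x = 0.
  move=> xc; rewrite /f wh0// w0 ?subrr ?mulr0//.
  apply: contra_not xc => xc i; rewrite (le_trans (xc i))// lerDl//.
have r10 : 0 <= r + 1 by rewrite addr_ge0.
have fcvg x : f n x @[n --> \oo] --> dw x.
  have [dx <-] := wd x.
  have hh : h n @[n --> \oo] --> (0 : R)^'.
    move=> A [e /= e0 eA].
    have := near_infty_natSinv_lt (PosNum e0); apply: filterS => n /= hn.
    apply: eA; last by rewrite gt_eqF.
    by rewrite /= sub0r normrN gtr0_norm.
  have := cvg_comp _ _ hh dx; apply: cvg_trans; apply: near_eq_cvg.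
  by apply: nearW => n; rewrite /f /= (addrC x).
have H := @dominated_convergence _ _ _ leb setT measurableT
   (fun n => EFin \o f n) (EFin \o dw) (EFin \o (M \o* \1_(cube a (r + 1)))).
have [||||_ _] := H _ _ _ (integrable_cst_cube a M r10).
- by move=> n; exact/measurable_EFinP.
- by apply/measurable_EFinP; exact: continuous_measurable_rV.
- by apply/aeW => x _; apply: cvg_EFin; [exact: nearW|exact: fcvg].
- apply/aeW => x n _; rewrite /= lee_fin indicE.
  have [xc|xc] := pselect (cube a (r + 1) x).
    by rewrite mem_set//= mul1r.
  by rewrite f0// normr0 mulr_ge0.
(* The real integral is 0 also by default when the extended one is infinite, so finiteness is
   established before [If] is transferred. *)
have E0 n : (\int[leb]_x (EFin \o f n) x = 0)%E.
  rewrite -[LHS]fineK; first by rewrite [fine _]If.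
  apply: integrable_fin_num => //.
  apply: (bounded_vanish_integrable r10 (mf n) (fM n)) => x; exact: f0.
under eq_fun do rewrite E0.
by rewrite /Rintegral => /cvg_lim <-//; rewrite lim_cst.
Qed.

Lemma Rintegral_vanish f (A : set V) : (forall x, ~ A x -> f x = 0) ->
  \int[leb]_(x in A) f x = \int[leb]_x f x.
Proof.
move=> f0; rewrite Rintegral_mkcond; congr (Rintegral _ _ _).
apply/funext => x; rewrite /patch; case: ifPn => // /negP.
by rewrite inE => /f0.
Qed.

(** The product of [u] with a test function vanishes off the cube, so both integrals extend to the
    whole space. Their sum is the integral of a classical partial derivative of that product, which
    is 0. *)
Lemma weak_partial_compact (Omega : set V) i u du a r : 0 <= r ->
  cube a r `<=` Omega ->
  (forall x, is_derive x (delta_mx ord0 i) u (du x)) ->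
  continuous u -> continuous du ->
  (forall x, ~ cube a r x -> u x = 0) -> (forall x, ~ cube a r x -> du x = 0) ->
  weak_partial Omega i u du.
Proof.
move=> r0 cO dud cu cdu u0 du0 phi [phiC _].
have [/(_ _ I) cphi /(_ isT i) dphi] := phiC 1%N [::] isT.
have [/(_ _ I) cdphi _] := phiC 1%N [:: i] isT.
rewrite /= in cphi dphi cdphi.
have c1 : continuous (fun x => u x * partial i phi x).
  move=> x; exact: (continuousM (cu x) (cdphi x)).
have c2 : continuous (fun x => du x * phi x).
  move=> x; exact: (continuousM (cdu x) (cphi x)).
have v1 x : ~ cube a r x -> u x * partial i phi x = 0 by move=> /u0 ->; rewrite mul0r.
have v2 x : ~ cube a r x -> du x * phi x = 0 by move=> /du0 ->; rewrite mul0r.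
have nO x : ~ Omega x -> ~ cube a r x by apply: contra_not; exact: cO.
rewrite (Rintegral_vanish (fun x Ox => v1 x (nO x Ox))).
rewrite (Rintegral_vanish (fun x Ox => v2 x (nO x Ox))).
apply/eqP; rewrite -addr_eq0; apply/eqP.
rewrite -(RintegralD measurableT (continuous_vanish_integrable r0 c1 v1)
  (continuous_vanish_integrable r0 c2 v2)).
apply: (@Rintegral_partial0 (fun x => u x * phi x) _ (delta_mx ord0 i) a r) => //.
- move=> x; have [_ E] := dud x.
  have pd : is_derive x (delta_mx ord0 i) phi (partial i phi x).
    by split=> //; exact: dphi.
  apply: is_derive_eq (is_deriveM (dud x) pd) _.
  by rewrite /= [phi x *: _]mulrC.
- move=> x; exact: (continuousM (cu x) (cphi x)).
- move=> x; exact: (continuousD (c1 x) (c2 x)).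
- by move=> j; rewrite mxE eqxx /=; case: (j == i); rewrite ?normr1 ?normr0.
- by move=> x /u0 ->; rewrite mul0r.
- by move=> x xc; rewrite v1// v2// addr0.
Qed.

End divergence.

(** * A C^2 bump function *)

Section bump.
Context (R : realType).

(** The truncated power, of class C^(k-1) for k at least 1; it supplies the finite smoothness of the
    bump. *)
Definition posX k (t : R) : R := Num.max t 0 ^+ k.

Lemma posX_continuous k : continuous (posX k).
Proof.
move=> t; apply: (@continuous_comp _ _ _ (fun t : R => Num.max t 0) (fun t => t ^+ k));
  last exact: exprn_continuous.
by apply: (@continuous_max R R idfun (cst 0)); [exact: cvg_id|exact: cvg_cst].
Qed.

Lemma is_derive_posX k (t : R) : is_derive t 1 (posX k.+2) (k.+2%:R * posX k.+1 t).
Proof.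
have [t0|t0|t0] := ltgtP t 0.
- apply: (near_eq_is_derive (f := cst 0)).
    near=> s; rewrite /posX max_r ?expr0n// ltW//.
    by near: s; exact: lt_nbhsl.
  by rewrite /posX max_r ?(ltW t0)// expr0n mulr0; exact: is_derive_cst.
- apply: (near_eq_is_derive (f := fun s : R => s ^+ k.+2)).
    near=> s; rewrite /posX max_l// ltW//.
    by near: s; exact: lt_nbhsr.
  rewrite /posX max_l ?(ltW t0)//.
  have -> : (fun s : R => s ^+ k.+2) = (id : R -> R) ^+ k.+2.
    by apply/funext => s; rewrite exprfctE.
  apply: is_derive_eq.
  by rewrite /= [LHS]mulr1.
(* At 0 the difference quotient equals [posX k.+1 h] for either sign of [h], and it tends to 0 by
   continuity. *)
- rewrite t0 {2}/posX maxxx expr0n mulr0.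
  have E : h^-1 *: ((posX k.+2 \o shift 0) (h *: 1) - posX k.+2 0) @[h --> 0^'] --> (0 : R).
    have : posX k.+1 h @[h --> (0 : R)^'] --> posX k.+1 0.
      by apply: cvg_within_filter; exact: posX_continuous.
    rewrite {2}/posX maxxx expr0n /=; apply: cvg_trans.
    apply: near_eq_cvg; near=> h.
    have h0 : h != 0 by near: h; exact: nbhs_dnbhs_neq.
    rewrite /= addr0 /posX maxxx (expr0n _ k.+2) /= subr0 [h%:A]mulr1.
    have [hh|hh] := leP h 0; first by rewrite !expr0n [RHS]mulr0.
    by rewrite [in RHS]exprS [RHS]mulrA mulVf// mul1r.
  split; first by apply/cvg_ex; exists 0.
  by apply: cvg_lim.
Unshelve. all: by end_near.
Qed.

Lemma posX_ge0 k (t : R) : 0 <= posX k t.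
Proof. by rewrite exprn_ge0// le_max lexx orbT. Qed.

Lemma posX_eq0 k (t : R) : t <= 0 -> posX k.+1 t = 0.
Proof. by move=> t0; rewrite /posX max_r// expr0n. Qed.

Lemma posX_le1 k (t : R) : t <= 1 -> posX k t <= 1.
Proof.
by move=> t1; rewrite exprn_ile1// ?le_max ?lexx ?orbT// ge_max t1 ler01.
Qed.

Lemma posX_ge k (s t : R) : 0 <= s -> s <= t -> s ^+ k <= posX k t.
Proof.
by move=> s0 st; rewrite lerXn2r// ?nnegrE// le_max ?st// lexx orbT.
Qed.

Context (N : nat).
Local Notation V := 'rV[R]_N.
Implicit Types (a x v : V) (r : R).

Lemma is_derive_lineV (f : V -> R) (df : R) v x :
  is_derive (0 : R) (1 : R) (fun s : R => f (x + s *: v)) df -> is_derive x v f df.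
Proof.
move=> [fd fv].
have E : (fun h : R => h^-1 *: (((fun s : R => f (x + s *: v)) \o shift 0) (h *: 1) -
    f (x + 0 *: v))) =
    (fun h : R => h^-1 *: ((f \o shift x) (h *: v) - f x)).
  apply/funext => h /=; rewrite addr0 scale0r addr0 (addrC x).
  by rewrite [h%:A]mulr1.
by move: fd fv; rewrite /derivable /derive E => fd fv; split.
Qed.

Definition sqdist a x : R := \sum_i (x ord0 i - a ord0 i) ^+ 2.

Definition paraboloid a r x : R := 1 - r ^- 2 * sqdist a x.

(** Supported in the closed Euclidean ball of radius [r] about [a], hence in [cube a r]. With
    exponent 3 the second derivatives involve only [posX 1] and [posX 2], so they are continuous. *)
Definition bump a r x : R := posX 3 (paraboloid a r x).

Definition dbump a r i x : R :=
  3 * posX 2 (paraboloid a r x) * (- r ^- 2 * (2 * (x ord0 i - a ord0 i))).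

(** Here [i] is the direction of the first differentiation and [j] that of the second. The last
    summand comes from differentiating the linear factor of [dbump]. *)
Definition ddbump a r i j x : R :=
  3 * (2 * posX 1 (paraboloid a r x) * (- r ^- 2 * (2 * (x ord0 j - a ord0 j))))
    * (- r ^- 2 * (2 * (x ord0 i - a ord0 i)))
  + 3 * posX 2 (paraboloid a r x) * (- r ^- 2 * (2 * (j == i)%:R)).

Lemma paraboloid_continuous a r : continuous (paraboloid a r).
Proof.
have c : continuous (sqdist a).
  have : continuous (fun x => \sum_(i <- index_enum 'I_N) (x ord0 i - a ord0 i) ^+ 2).
    apply: continuous_big => [|i _ x]; first exact: add_continuous.
    apply: (@continuous_comp _ _ _ (fun x : V => x ord0 i - a ord0 i) (fun t : R => t ^+ 2));
      last exact: exprn_continuous.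
    exact: (continuousB (@coord_continuous R 1 N ord0 i x) (@cst_continuous _ _ (a ord0 i) x)).
  by [].
move=> x; apply: (@continuousB R R V (cst 1) (cst (r ^- 2) \* sqdist a)).
  exact: cst_continuous.
by apply: continuousM; [exact: cst_continuous|exact: c].
Qed.

Lemma is_derive_coordB a j i x :
  is_derive x (delta_mx ord0 j) (fun y : V => y ord0 i - a ord0 i) (j == i)%:R.
Proof.
apply: is_derive_lineV.
rewrite (_ : (fun _ => _) = (fun s : R => (j == i)%:R *: s + (x ord0 i - a ord0 i))).
  by apply: is_derive_eq; rewrite addr0 [LHS]mulr1.
apply/funext => s; rewrite !mxE eqxx /= eq_sym mulrC addrAC addrC.
by rewrite addrC.
Qed.

Lemma is_derive_paraboloid a r j x :
  is_derive x (delta_mx ord0 j) (paraboloid a r)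
    (- r ^- 2 * (2 * (x ord0 j - a ord0 j))).
Proof.
rewrite (_ : paraboloid a r = cst 1 - r ^- 2 *:
    \sum_(i < N) (fun y : V => y ord0 i - a ord0 i) ^+ 2); last first.
  apply/funext => y; rewrite /paraboloid /sqdist /=.
  by rewrite fctE /= scalrfctE fct_sumE.
have H i := is_deriveX 2 (is_derive_coordB a j i x).
apply: (is_derive_eq (is_deriveB (is_derive_cst (1 : R) x (delta_mx ord0 j))
  (is_deriveZ (r ^- 2) (is_derive_sum H)))).
rewrite sub0r /= -mulNr; congr (_ * _).
rewrite (bigD1 j)//= big1 => [|i ij]; last by rewrite eq_sym (negbTE ij) scaler0.
by rewrite eqxx addr0 expr1 [LHS]mulr1.
Qed.

(** The chain rule, carried out on the coordinate line through [x], where the one-variable rule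
    applies. *)
Lemma is_derive_posX_paraboloid a r k j x :
  is_derive x (delta_mx ord0 j) (fun x => posX k.+2 (paraboloid a r x))
    (k.+2%:R * posX k.+1 (paraboloid a r x) *
      (- r ^- 2 * (2 * (x ord0 j - a ord0 j)))).
Proof.
apply: is_derive_lineV.
have h0 : x + (0 : R) *: delta_mx ord0 j = x by rewrite scale0r addr0.
apply: (@is_derive1_comp R (posX k.+2)
  (fun s : R => paraboloid a r (x + s *: delta_mx ord0 j)) 0).
  by rewrite h0; exact: is_derive_posX.
by apply: is_derive_line; rewrite h0; exact: is_derive_paraboloid.
Qed.

Lemma is_derive_bump a r j x :
  is_derive x (delta_mx ord0 j) (bump a r) (dbump a r j x).
Proof. exact: (is_derive_posX_paraboloid a r 1 j x). Qed.

Lemma is_derive_dbump a r i j x :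
  is_derive x (delta_mx ord0 j) (dbump a r i) (ddbump a r i j x).
Proof.
rewrite (_ : dbump a r i = (3 *: (fun x => posX 2 (paraboloid a r x)) : V -> R) *
  (- r ^- 2 *: (2 *: (fun y : V => y ord0 i - a ord0 i)))); last exact/funext.
apply: (is_derive_eq (is_deriveM
  (is_deriveZ 3 (is_derive_posX_paraboloid a r 0 j x))
  (is_deriveZ (- r ^- 2) (is_deriveZ 2 (is_derive_coordB a j i x))))).
rewrite /ddbump /= /GRing.scale/=. ring.
Qed.

End bump.

(** * L^2 norms and the domain of the Laplacian *)

Section Lp_norms.
Context (R : realType) (N : nat).
Local Notation V := 'rV[R]_N.
Local Notation leb := (lebesgue_rV R N).
Implicit Types (f g h u : V -> R) (D : set V).

Lemma measurable_patch D f : measurable D -> measurable_fun D f ->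
  measurable_fun setT (f \_ D).
Proof.
by move=> mD mf; apply/(measurable_restrictT _ mD).
Qed.

Lemma EFin_patch D f : (EFin \o f) \_ D = EFin \o (f \_ D).
Proof. by apply/funext => x; rewrite /patch /=; case: ifP. Qed.

Lemma Lp_norm2_sqr D f :
  ((Lp_norm D 2%:E f) `^ 2 = \int[leb]_(x in D) (f x ^+ 2)%:E)%E.
Proof.
rewrite /Lp_norm poweR_Lnorm ?pnatr_eq0// [RHS]integral_mkcond.
apply: eq_integral => x _; rewrite EFin_patch /= powR_mulrn//.
by rewrite real_normK ?num_real// /patch; case: ifP => // _; rewrite expr0n.
Qed.

(** Squaring is monotone on nonnegative values, and an infinite norm has an infinite square. The L^2
    estimates below are made on the integral of the square. *)
Lemma Lp_norm2_leP D f (c : R) : 0 <= c ->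
  (Lp_norm D 2%:E f <= c%:E)%E <-> (\int[leb]_(x in D) (f x ^+ 2)%:E <= (c ^+ 2)%:E)%E.
Proof.
move=> c0; rewrite -Lp_norm2_sqr.
have := Lnorm_ge0 leb 2%:E ((EFin \o f) \_ D); rewrite -/(Lp_norm _ _ _).
case: (Lp_norm _ _ _) => [s| |]//.
  rewrite lee_fin => s0; rewrite poweR_EFin powR_mulrn// !lee_fin.
  by rewrite ler_sqr ?nnegrE.
move=> _; rewrite (eqy_poweR (ltr0n R 2) erefl).
by rewrite !leye_eq.
Qed.

(** Transfers norm bounds along identities such as the semigroup law, which hold only almost
    everywhere. *)
Lemma Lp_norm2_ae_le D f g : measurable D -> measurable_fun D f ->
  measurable_fun D g -> {ae leb, forall x, D x -> f x = g x} ->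
  forall c : R, 0 <= c -> (Lp_norm D 2%:E f <= c%:E)%E -> (Lp_norm D 2%:E g <= c%:E)%E.
Proof.
move=> mD mf mg fg c c0 /(Lp_norm2_leP _ _ c0) h; apply/(Lp_norm2_leP _ _ c0).
rewrite (ae_eq_integral (fun x => (f x ^+ 2)%:E))//.
- by apply/measurable_EFinP; exact: measurable_funX.
- by apply/measurable_EFinP; exact: measurable_funX.
- by apply: filterS fg => x fg Dx; rewrite fg.
Qed.

Lemma Lp_norm_triangle D p f g : measurable D -> measurable_fun D f ->
  measurable_fun D g -> (1 <= p)%E ->
  (Lp_norm D p (fun x => f x + g x)%R <= Lp_norm D p f + Lp_norm D p g)%E.
Proof.
move=> mD mf mg p1; rewrite /Lp_norm !EFin_patch.
have := eminkowski leb (measurable_patch mD mf) (measurable_patch mD mg) p1.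
apply: le_trans; rewrite le_eqVlt; apply/orP; left; apply/eqP; apply: eq_Lnorm => x.
by rewrite /= /patch; case: ifP => //; rewrite addr0.
Qed.

Lemma Lp_norm2Z D f (k c : R) : measurable D -> measurable_fun D f -> 0 <= k -> 0 <= c ->
  (Lp_norm D 2%:E f <= c%:E)%E ->
  (Lp_norm D 2%:E (fun x => k * f x)%R <= (k * c)%:E)%E.
Proof.
move=> mD mf k0 c0 /(Lp_norm2_leP _ _ c0) h; apply/Lp_norm2_leP; first exact: mulr_ge0.
under eq_integral do rewrite exprMn EFinM.
rewrite ge0_integralZl//; last 3 first.
- by apply/measurable_EFinP; exact: measurable_funX.
- by move=> x _; rewrite lee_fin sqr_ge0.
- by rewrite lee_fin sqr_ge0.
rewrite exprMn (EFinM (k ^+ 2)); apply: lee_wpmul2l => //.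
by rewrite lee_fin sqr_ge0.
Qed.

Lemma Lp_norm2_bounded D f a r (M : R) : measurable D -> measurable_fun D f ->
  0 <= r -> 0 <= M ->
  (forall x, `|f x| <= M) -> (forall x, ~ cube a r x -> f x = 0) ->
  (Lp_norm D 2%:E f <= (M * Num.sqrt ((r *+ 2) ^+ N))%:E)%E.
Proof.
move=> mD mf r0 M0 fM f0.
have r20 : 0 <= (r *+ 2) ^+ N by rewrite exprn_ge0// mulrn_wge0.
have mc := measurable_cube a r.
apply/Lp_norm2_leP; first by rewrite mulr_ge0// sqrtr_ge0.
rewrite exprMn sqr_sqrtr//.
apply: (@le_trans _ _ (\int[leb]_(x in D) ((M ^+ 2)%:E * (\1_(cube a r) x)%:E))%E).
  apply: ge0_le_integral => //.
  - by move=> x _; rewrite lee_fin sqr_ge0.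
  - by apply/measurable_EFinP; exact: measurable_funX.
  - apply/measurable_EFinP; apply: measurable_funM => //; exact: measurable_indic.
  - move=> x _; rewrite -EFinM lee_fin indicE.
    have [xc|xc] := pselect (cube a r x).
      by rewrite mem_set//= mulr1 -(real_normK (num_real (f x))) lerXn2r// nnegrE.
    by rewrite f0// expr0n mulr_ge0// sqr_ge0.
rewrite ge0_integralZl//; last 2 first.
- by apply/measurable_EFinP; exact: measurable_indic.
- by rewrite lee_fin sqr_ge0.
rewrite integral_indic// (EFinM (M ^+ 2)); apply: lee_wpmul2l.
  by rewrite lee_fin sqr_ge0.
rewrite -(lebesgue_rV_cube a r0); apply: le_measure; rewrite ?inE//.
exact: measurableI.
Qed.

Lemma in_Lp2_bounded D f a r (M : R) : measurable D -> measurable_fun D f ->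
  0 <= r -> 0 <= M ->
  (forall x, `|f x| <= M) -> (forall x, ~ cube a r x -> f x = 0) ->
  in_Lp D 2%:E f.
Proof.
move=> mD mf r0 M0 fM f0; split => //.
exact: le_lt_trans (Lp_norm2_bounded mD mf r0 M0 fM f0) (ltry _).
Qed.

End Lp_norms.

(** * Bounds on the bump and its membership in the domain of the Laplacian *)

Section bump_laplacian.
Context (R : realType) (N : nat).
Local Notation V := 'rV[R]_N.
Local Notation leb := (lebesgue_rV R N).
Implicit Types (a x v : V) (r : R).

Lemma paraboloid_le1 a r x : paraboloid a r x <= 1.
Proof.
rewrite gerBl mulr_ge0// ?invr_ge0 ?exprn_even_ge0//.
by apply: sumr_ge0 => i _; exact: sqr_ge0.
Qed.

(** Outside the cube a single coordinate already makes the Euclidean distance to [a] exceed [r]. *)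
Lemma paraboloid_le0 a r x : 0 < r -> ~ cube a r x -> paraboloid a r x <= 0.
Proof.
move=> r0 xc; have [i] : exists i, r < `|x ord0 i - a ord0 i|.
  apply/not_existsP => h; apply: xc => i.
  by rewrite leNgt; apply/negP; exact: h.
move=> ri; rewrite subr_le0 ler_pdivlMl ?exprn_gt0// mulr1.
rewrite /sqdist (bigD1 i)//= ler_wpDr ?sumr_ge0//; first by move=> j _; exact: sqr_ge0.
by rewrite -(real_normK (num_real (_ - _))) lerXn2r ?nnegrE// ltW.
Qed.

(** On the small cube the squared distance is at most N (r / 2N)^2 = r^2 / (4N), which is below r^2
    / 2. In dimension 0 the sum of squares is empty. *)
Lemma paraboloid_ge a r x : 0 < r -> cube a (r / 2 / N%:R) x ->
  1 / 2 <= paraboloid a r x.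
Proof.
move=> r0 xc; have [N0|N0] := posnP N.
  rewrite /paraboloid /sqdist big1 ?mulr0 ?subr0; first by lra.
  by move=> i; have := ltn_ord i; rewrite [X in (_ < X)%N]N0.
rewrite /paraboloid lerBrDr -lerBrDl ler_pdivrMl ?exprn_gt0//.
apply: (@le_trans _ _ (\sum_(i < N) (r / 2 / N%:R) ^+ 2)).
  apply: ler_sum => i _; rewrite -(real_normK (num_real (_ - _))).
  by rewrite lerXn2r ?nnegrE// ?divr_ge0// ?ltW.
rewrite sumr_const card_ord -[leLHS]mulr_natr.
have N1 : (1 : R) <= N%:R by rewrite ler1n.
have -> : (r / 2 / N%:R) ^+ 2 * N%:R = r ^+ 2 * (1 / 4 / N%:R) :> R.
  by field; rewrite pnatr_eq0 -lt0n N0.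
rewrite ler_pM2l ?exprn_gt0// ler_pdivrMr ?ltr0n//. lra.
Qed.

Lemma bump_ge0 a r x : 0 <= bump a r x. Proof. exact: posX_ge0. Qed.

Lemma bump_le1 a r x : bump a r x <= 1.
Proof. by apply: posX_le1; exact: paraboloid_le1. Qed.

Lemma bump_ge a r x : 0 < r -> cube a (r / 2 / N%:R) x -> 1 / 8 <= bump a r x.
Proof.
move=> r0 xc; rewrite (_ : 1 / 8 = (1 / 2) ^+ 3); last by field.
by apply: posX_ge; [lra|exact: paraboloid_ge].
Qed.

Lemma bump_eq0 a r x : 0 < r -> ~ cube a r x -> bump a r x = 0.
Proof. by move=> r0 xc; apply: posX_eq0; exact: paraboloid_le0. Qed.

Lemma dbump_eq0 a r i x : 0 < r -> ~ cube a r x -> dbump a r i x = 0.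
Proof.
by move=> r0 xc; rewrite /dbump posX_eq0 ?mulr0 ?mul0r//; exact: paraboloid_le0.
Qed.

Lemma ddbump_eq0 a r i j x : 0 < r -> ~ cube a r x -> ddbump a r i j x = 0.
Proof.
move=> r0 xc; rewrite /ddbump !posX_eq0 ?(mulr0, mul0r, addr0)//;
  exact: paraboloid_le0.
Qed.

(** With c = r^-2 and d the i-th coordinate of x - a, the value is (24 p c d^2 - 6 q) c, where p, q
    and c d^2 lie in [0, 1] on the cube. The constant is 30 = 24 + 6. *)
Lemma ddbump_le a r i x : 0 < r -> `|ddbump a r i i x| <= 30 * r ^- 2.
Proof.
move=> r0; have [xc|xc] := pselect (cube a r x); last first.
  by rewrite ddbump_eq0// normr0 mulr_ge0// invr_ge0 exprn_ge0// ltW.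
have c0 : 0 < r ^- 2 by rewrite invr_gt0 exprn_gt0.
rewrite /ddbump eqxx mulr1.
set c := r ^- 2 in c0 *; set d := x ord0 i - a ord0 i.
set p := posX 1 _; set q := posX 2 _.
have p0 : 0 <= p by exact: posX_ge0.
have p1 : p <= 1 by apply: posX_le1; exact: paraboloid_le1.
have q0 : 0 <= q by exact: posX_ge0.
have q1 : q <= 1 by apply: posX_le1; exact: paraboloid_le1.
have cd : c * d ^+ 2 <= 1.
  rewrite /c ler_pdivrMl ?exprn_gt0// mulr1 -(real_normK (num_real d)).
  by rewrite lerXn2r ?nnegrE ?(ltW r0)//; exact: (xc i).
have cd0 : 0 <= c * d ^+ 2 by rewrite mulr_ge0 ?sqr_ge0// ltW.
have -> : 3 * (2 * p * (- c * (2 * d))) * (- c * (2 * d)) + 3 * q * (- c * 2) =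
    (24 * (p * (c * d ^+ 2)) - 6 * q) * c by ring.
rewrite normrM (gtr0_norm c0) ler_pM2r//.
have h1 : p * (c * d ^+ 2) <= 1 by rewrite mulr_ile1.
have h2 : 0 <= p * (c * d ^+ 2) by rewrite mulr_ge0.
rewrite ler_norml; apply/andP; split; lra.
Qed.

Lemma posX_paraboloid_continuous a r k : continuous (fun x => posX k (paraboloid a r x)).
Proof.
move=> x; apply: (@continuous_comp _ _ _ (paraboloid a r) (posX k)).
  exact: paraboloid_continuous.
exact: posX_continuous.
Qed.

Lemma bump_continuous a r : continuous (bump a r).
Proof. exact: posX_paraboloid_continuous. Qed.

Lemma continuousMl (c : R) (f : V -> R) : continuous f -> continuous (fun x => c * f x).
Proof.
move=> cf x; apply: (@continuousM R V (cst c) f); last exact: cf.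
exact: cst_continuous.
Qed.

Lemma slope_continuous a r i :
  continuous (fun x : V => - r ^- 2 * (2 * (x ord0 i - a ord0 i))).
Proof.
apply: continuousMl; apply: continuousMl => x.
exact: (continuousB (@coord_continuous R 1 N ord0 i x) (@cst_continuous _ _ (a ord0 i) x)).
Qed.

Lemma dbump_continuous a r i : continuous (dbump a r i).
Proof.
move=> x; apply: (@continuousM R V (fun x => 3 * posX 2 (paraboloid a r x)));
  last exact: slope_continuous.
by apply: continuousMl; exact: posX_paraboloid_continuous.
Qed.

Lemma ddbump_continuous a r i j : continuous (ddbump a r i j).
Proof.
move=> x; apply: (@continuousD R R V (fun x => 3 * (2 * posX 1 (paraboloid a r x) *
    (- r ^- 2 * (2 * (x ord0 j - a ord0 j)))) * (- r ^- 2 * (2 * (x ord0 i - a ord0 i))))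
    (fun x => 3 * posX 2 (paraboloid a r x) * (- r ^- 2 * (2 * (j == i)%:R)))).
  apply: (@continuousM R V (fun x => 3 * (2 * posX 1 (paraboloid a r x) *
    (- r ^- 2 * (2 * (x ord0 j - a ord0 j)))))); last exact: slope_continuous.
  apply: continuousMl => {}x.
  apply: (@continuousM R V (fun x => 2 * posX 1 (paraboloid a r x)));
    last exact: slope_continuous.
  by apply: continuousMl; exact: posX_paraboloid_continuous.
apply: (@continuousM R V (fun x => 3 * posX 2 (paraboloid a r x))
  (cst (- r ^- 2 * (2 * (j == i)%:R)))); last exact: cst_continuous.
by apply: continuousMl; exact: posX_paraboloid_continuous.
Qed.

(** The classical derivatives are also the weak ones, since everything is supported in a cube inside
    [Omega]. The bump and its first derivatives have zero trace, so the boundary condition holds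
    whatever [theta] is. *)
Lemma laplacian_bump (Omega : set V) (theta : V -> R) a r :
  open Omega -> 0 < r -> cube a r `<=` Omega ->
  laplacian Omega theta (bump a r) (fun x => \sum_i ddbump a r i i x).
Proof.
move=> oO r0 cO; have mO := open_measurable_rV oO.
have r0' := ltW r0.
have D1 : (fun i => partial i (bump a r)) = dbump a r.
  apply/funext => i; apply/funext => x.
  exact: (@derive_val _ _ _ _ _ _ _ (is_derive_bump a r i x)).
have D2 i : (fun j => partial j (dbump a r i)) = ddbump a r i.
  apply/funext => j; apply/funext => x.
  exact: (@derive_val _ _ _ _ _ _ _ (is_derive_dbump a r i j x)).
have L2 f : continuous f -> (forall x, ~ cube a r x -> f x = 0) -> in_Lp Omega 2%:E f.
  move=> cf f0; have [M M0 fM] := continuous_vanish_bounded cf f0.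
  apply: (in_Lp2_bounded mO _ r0' M0 fM f0).
  apply: measurable_funTS; exact: continuous_measurable_rV.
have bu0 x := @bump_eq0 a r x r0.
have db0 i x := @dbump_eq0 a r i x r0.
have ddb0 i j x := @ddbump_eq0 a r i j x r0.
have W1 : in_W12 Omega (bump a r) (dbump a r).
  split; first by apply: L2; [exact: bump_continuous|exact: bu0].
  move=> i; split; first by apply: L2; [exact: dbump_continuous|exact: db0].
  apply: (weak_partial_compact r0' cO (is_derive_bump a r i)) => //.
  - exact: bump_continuous.
  - exact: dbump_continuous.
  - exact: db0.
have W2 i : in_W12 Omega (dbump a r i) (ddbump a r i).
  split; first by apply: L2; [exact: dbump_continuous|exact: db0].
  move=> j; split; first by apply: L2; [exact: ddbump_continuous|exact: ddb0].
  apply: (weak_partial_compact r0' cO (is_derive_dbump a r i j)) => //.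
  - exact: dbump_continuous.
  - exact: ddbump_continuous.
  - exact: db0.
  - exact: ddb0.
have trace0 u (du : 'I_N -> V -> R) : in_W12 Omega u du ->
    (forall i x, is_derive x (delta_mx ord0 i) u (du i x)) ->
    continuous u -> (forall i, continuous (du i)) ->
    (forall x, ~ cube a r x -> u x = 0) -> is_trace Omega u du (cst 0).
  move=> W du_d cu cdu u0; split; first exact: measurable_cst.
  have Du : (fun i => partial i u) = du.
    apply/funext => i; apply/funext => x.
    exact: (@derive_val _ _ _ _ _ _ _ (du_d i x)).
  have norm0 f : Lp_norm Omega 2%:E (f \- f) = 0%E.
    rewrite /Lp_norm (_ : (EFin \o _) \_ _ = cst 0%E) ?Lnorm0//.
    by apply/funext => x; rewrite /patch /= subrr; case: ifP.
  (* [u] is C^1 and approximates itself by a constant sequence. Boundary points lie outside the open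
     set [Omega], hence outside the cube, so [u] vanishes there. *)
  exists (fun=> u); split.
  - move=> _; split; last by rewrite Du.
    move=> [|i [|//]] _; split => [x _|].
    + exact: cu.
    + by move=> _ i x _; exact: (@ex_derive _ _ _ _ _ _ _ (du_d i x)).
    + by rewrite /= -[partial i u]/((fun i => partial i u) i) Du; exact: cdu.
    + by [].
  - by rewrite norm0; exact: cvg_cst.
  - move=> i; rewrite -[partial i u]/((fun i => partial i u) i) Du norm0.
    exact: cvg_cst.
  - rewrite integral0_eq; first exact: cvg_cst.
    move=> x [_ /= xO]; rewrite u0 ?subrr ?expr0n// => /cO.
    by have /interior_id <- := oO.
exists (dbump a r), (ddbump a r); split.
- by split.
- exists (cst 0), (fun=> cst 0); split.
  + by apply: trace0; [exact: W1|exact: is_derive_bump|exact: bump_continuous|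
      exact: dbump_continuous|exact: bu0].
  + by move=> i; apply: trace0; [exact: W2|exact: is_derive_dbump|
      exact: dbump_continuous|exact: ddbump_continuous|exact: db0].
  + apply/aeW => x _ n _; rewrite big1 ?mulr0 ?addr0// => i _.
    by rewrite mul0r.
- exact/aeW.
Qed.

End bump_laplacian.

(** * Short-time deviation of the heat semigroup *)

Section bump_mass.
Context (R : realType) (N : nat).
Local Notation V := 'rV[R]_N.
Local Notation leb := (lebesgue_rV R N).
Context (Omega : set V) (oO : open Omega).
Implicit Types (a : V) (r : R).

Let mO : measurable Omega := open_measurable_rV oO.

Lemma measurable_bump a r : measurable_fun Omega (bump a r).
Proof.
by apply: measurable_funTS; apply: continuous_measurable_rV; exact: bump_continuous.
Qed.

Lemma bump_norm_le1 a r x : `|bump a r x| <= 1.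
Proof. by rewrite ger0_norm ?bump_ge0// bump_le1. Qed.

Lemma in_Lp1_bump a r : 0 < r -> in_Lp Omega 1%:E (bump a r).
Proof.
move=> r0; have mb := measurable_bump a r.
split => //; rewrite /Lp_norm Lnorm1 EFin_patch.
have : leb.-integrable setT (EFin \o (bump a r \_ Omega)).
  apply: (@bounded_vanish_integrable _ _ _ a r 1 (ltW r0)).
  - exact: measurable_patch.
  - by move=> x; rewrite /patch; case: ifP => _; rewrite ?bump_norm_le1// normr0 ler01.
  - by move=> x xc; rewrite /patch bump_eq0//; case: ifP.
by move=> /integrableP[].
Qed.

Lemma in_Lp2_bump a r : 0 < r -> in_Lp Omega 2%:E (bump a r).
Proof.
move=> r0; apply: (in_Lp2_bounded mO (measurable_bump a r) (ltW r0) ler01).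
- exact: bump_norm_le1.
- by move=> x; exact: bump_eq0.
Qed.

Definition bump_mass a r : R := \int[leb]_(x in Omega) bump a r x.

Lemma bump_massE a r : 0 < r ->
  (bump_mass a r)%:E = (\int[leb]_(x in Omega) (bump a r x)%:E)%E.
Proof.
move=> r0; rewrite /bump_mass /Rintegral fineK//.
have [mb] := in_Lp1_bump a r0.
rewrite /Lp_norm Lnorm1 EFin_patch => h.
apply: integrable_fin_num => //; apply/integrableP; split; first exact/measurable_EFinP.
rewrite integral_mkcond; apply: le_lt_trans h; rewrite le_eqVlt; apply/orP; left.
apply/eqP; apply: eq_integral => x _; rewrite /patch /=.
by case: ifP => //; rewrite normr0.
Qed.

Lemma bump_mass_le a r : 0 < r -> bump_mass a r <= (r *+ 2) ^+ N.
Proof.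
move=> r0; rewrite -lee_fin bump_massE// -(lebesgue_rV_cube a (ltW r0)).
have mc := measurable_cube a r.
apply: (@le_trans _ _ (\int[leb]_(x in Omega) (\1_(cube a r) x)%:E)%E).
  apply: ge0_le_integral => //.
  - by move=> x _; rewrite lee_fin bump_ge0.
  - by apply/measurable_EFinP; exact: measurable_bump.
  - by apply/measurable_EFinP; exact: measurable_indic.
  - move=> x _; rewrite lee_fin indicE; have [xc|xc] := pselect (cube a r x).
      by rewrite mem_set//= bump_le1.
    by rewrite bump_eq0.
by rewrite integral_indic//; apply: le_measure; rewrite ?inE//; exact: measurableI.
Qed.

Lemma cube_core a r : 0 < r -> cube a (r / 2 / N%:R) `<=` cube a r.
Proof.
move=> r0 x xc i; apply: (le_trans (xc i)).
(* The coordinate [i] at hand forces a positive dimension, so the division by [N] is a genuine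
   one. *)
have N0 : (0 < N)%N by apply: leq_trans (ltn_ord i).
rewrite -mulrA ler_piMr ?(ltW r0)//.
rewrite -invfM invf_le1 ?mulr_gt0 ?ltr0n//.
by rewrite -natrM ler1n muln_gt0.
Qed.

(** The bump is at least 1/8 on the concentric cube of half-side r / (2N). Exponent 1 serves the
    lower bound on the mass, exponent 2 the L^2 comparison with the evolved bump. *)
Lemma bump_power_ge n a r : 0 < r ->
  (((1 / 8) ^+ n * (r / N%:R) ^+ N)%:E <= \int[leb]_(x in cube a r) (bump a r x ^+ n)%:E)%E.
Proof.
move=> r0; have mc := measurable_cube a r.
have mc' := measurable_cube a (r / 2 / N%:R).
have rN : 0 <= r / 2 / N%:R by rewrite !divr_ge0// ltW.
have mb : measurable_fun setT (fun x => (bump a r x ^+ n)%:E).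
  apply/measurable_EFinP; apply: measurable_funX.
  by apply: continuous_measurable_rV; exact: bump_continuous.
apply: (@le_trans _ _ (\int[leb]_(x in cube a (r / 2 / N%:R)) (bump a r x ^+ n)%:E)%E);
  last first.
  apply: ge0_subset_integral => //; first exact: measurable_funTS.
    by move=> x _; rewrite lee_fin exprn_ge0// bump_ge0.
  exact: cube_core.
apply: (@le_trans _ _ (\int[leb]_(x in cube a (r / 2 / N%:R)) ((1 / 8) ^+ n)%:E)%E).
  rewrite integral_cst//= lebesgue_rV_cube// EFinM.
  by rewrite (_ : (r / 2 / N%:R) *+ 2 = r / N%:R)// -mulr_natr mulrAC divfK.
apply: ge0_le_integral => //.
- exact: measurable_funTS.
- move=> x xc; rewrite lee_fin lerXn2r ?nnegrE ?bump_ge0 ?bump_ge//.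
Qed.

End bump_mass.

(** * Deviation of the semigroup from the identity, and the mass kept by a bump *)

Section heat_semigroup.
Context (R : realType) (N : nat).
Local Notation V := 'rV[R]_N.
Local Notation leb := (lebesgue_rV R N).
Context (Omega : set V) (oO : open Omega) (theta : V -> R).
Context (k : V -> V -> R -> R) (hk : is_heat_kernel Omega theta k).
Local Notation S := (heat_op Omega k).
Local Notation norm2 := (Lp_norm Omega 2%:E).
Implicit Types (u v f : V -> R) (s t c : R) (a : V).

Let mO : measurable Omega := open_measurable_rV oO.

Let le12 : (1 <= 2%:E :> \bar R)%E. Proof. by rewrite lee_fin ler1n. Qed.

Lemma in_Lp2B u v : in_Lp Omega 2%:E u -> in_Lp Omega 2%:E v ->
  in_Lp Omega 2%:E (fun x => u x - v x).
Proof.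
move=> [mu nu] [mv nv]; split; first exact: measurable_funB.
have mNv : measurable_fun Omega (fun x => - v x) by exact: measurableT_comp.
apply: (le_lt_trans (Lp_norm_triangle mO mu mNv le12)); apply: lte_add_pinfty => //.
rewrite /Lp_norm (_ : _ \_ _ = (\- ((EFin \o v) \_ Omega))%E) ?oppe_Lnorm//.
by apply/funext => x; rewrite /patch /=; case: ifP => //; rewrite oppe0.
Qed.

Lemma in_Lp2_heat u t : 0 < t -> in_Lp Omega 2%:E u -> in_Lp Omega 2%:E (S t u).
Proof. by move=> t0 Lu; have [] := heat_kernel_contraction hk le12 Lu t0. Qed.

(** Linearity of the integral requires absolute convergence, which the kernel grants at almost every
    [x]. *)
Lemma heat_opB u v t : 0 < t -> in_Lp Omega 2%:E u -> in_Lp Omega 2%:E v ->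
  {ae leb, forall x, Omega x -> S t (fun x => u x - v x) x = S t u x - S t v x}.
Proof.
move=> t0 Lu Lv; have := heat_kernel_integrable hk le12 Lu t0.
have := heat_kernel_integrable hk le12 Lv t0.
apply: filterS2 => x iv iu Ox; rewrite -RintegralB//; [|exact: iu|exact: iv].
by apply: eq_Rintegral => y _; rewrite mulrBr.
Qed.

(** S(s+t)u - u = S(s)(S(t)u - u) + (S(s)u - u), and S(s) is a contraction. *)
Lemma heat_deviation_add u s t (c d : R) : 0 < s -> 0 < t -> 0 <= c -> 0 <= d ->
  in_Lp Omega 2%:E u ->
  (norm2 (fun x => S s u x - u x)%R <= c%:E)%E ->
  (norm2 (fun x => S t u x - u x)%R <= d%:E)%E ->
  (norm2 (fun x => S (s + t) u x - u x)%R <= (d + c)%:E)%E.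
Proof.
move=> s0 t0 c0 d0 Lu hs ht.
have Ls := in_Lp2_heat s0 Lu; have Lt := in_Lp2_heat t0 Lu.
have Lst := in_Lp2_heat (addr_gt0 s0 t0) Lu.
have Ld := in_Lp2B Lt Lu.
have [LSd hSd] := heat_kernel_contraction hk le12 Ld s0.
have Ldev := in_Lp2B Ls Lu.
apply: (@Lp_norm2_ae_le _ _ _
  (fun x => S s (fun x => S t u x - u x) x + (S s u x - u x))) => //.
- by apply: measurable_funD; [case: LSd|case: Ldev].
- by case: (in_Lp2B Lst Lu).
- have H1 := heat_kernel_semigroup hk le12 Lu s0 t0.
  have H2 := heat_opB s0 Lt Lu.
  by apply: filterS2 H1 H2 => x h1 h2 Ox; rewrite h1// h2// subrKA.
- exact: addr_ge0.
- apply: le_trans (Lp_norm_triangle mO _ _ le12) _.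
  + by case: LSd.
  + by case: Ldev.
  by rewrite (EFinD d c); apply: leeD => //; exact: le_trans hSd _.
Qed.

Lemma heat_deviation_mul u t (c : R) n : 0 < t -> 0 <= c ->
  in_Lp Omega 2%:E u ->
  (norm2 (fun x => S t u x - u x)%R <= c%:E)%E ->
  (norm2 (fun x => S (n.+1%:R * t) u x - u x)%R <= (n.+1%:R * c)%:E)%E.
Proof.
move=> t0 c0 Lu h; elim: n => [|n IH]; first by rewrite !mul1r.
have E d : n.+2%:R * d = d + n.+1%:R * d :> R.
  by rewrite -[n.+2]add1n natrD mulrDl mul1r.
rewrite (E t) (E c) (addrC c).
by apply: heat_deviation_add => //; [exact: mulr_gt0|exact: mulr_ge0].
Qed.

(* Subdivide [0, t] into steps so short that the difference quotient of the
   semigroup is [c]-close to [f]; the deviations of the steps add up. *)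
Lemma heat_deviation_generator u f t (c : R) : 0 < t -> 0 < c ->
  in_Lp Omega 2%:E u -> in_Lp Omega 2%:E f -> laplacian Omega theta u f ->
  (norm2 f <= c%:E)%E ->
  (norm2 (fun x => S t u x - u x)%R <= (t * (c *+ 2))%:E)%E.
Proof.
move=> t0 c0 Lu Lf uf fc.
have [_ _ _ /(_ _ _ Lu Lf) [_ /(_ uf) gen]] := heat_kernel_generated hk.
have : \forall h \near (0 : R)^'+, (norm2 (fun x => (S h u x - u x) / h - f x)%R < c%:E)%E.
  apply: (gen [set z | (z < c%:E)%E]); apply: open_nbhs_nbhs; split.
    exact: open_ereal_lt_ereal.
  by rewrite /= lte_fin.
move=> [e /= e0 he].
(* The step t / (n+1) has to fall below [e], the range in which the difference quotient is close to
   [f]. *)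
have [n ne] : exists n : nat, n.+1%:R^-1 < e / t.
  have := near_infty_natSinv_lt (PosNum (divr_gt0 e0 t0)).
  by move=> [n _ /(_ n)] /= h; exists n; exact: h.
pose h := n.+1%:R^-1 * t.
have h0 : 0 < h by rewrite mulr_gt0// invr_gt0.
have hlt : (norm2 (fun x => (S h u x - u x) / h - f x)%R < c%:E)%E.
  by apply: he => //=; rewrite sub0r normrN gtr0_norm// -ltr_pdivlMr.
have Ld := in_Lp2B (in_Lp2_heat h0 Lu) Lu.
have mq : measurable_fun Omega (fun x => (S h u x - u x) / h).
  by apply: measurable_funM => //; case: Ld.
have mq' : measurable_fun Omega (fun x => h^-1 * (S h u x - u x)).
  by apply: measurable_funM => //; case: Ld.
(* The factor 2 is made of one [c] for the distance of the quotient to [f] and one for the norm of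
   [f]. *)
have q2 : (norm2 (fun x => h^-1 * (S h u x - u x))%R <= (c *+ 2)%:E)%E.
  rewrite (_ : (fun _ => _) = (fun x => ((S h u x - u x) / h - f x) + f x)); last first.
    by apply/funext => x; rewrite subrK mulrC.
  apply: le_trans (Lp_norm_triangle mO _ _ le12) _.
  - by apply: measurable_funB => //; case: Lf.
  - by case: Lf.
  by rewrite mulr2n (EFinD c c); apply: leeD => //; exact: ltW.
have c20 : 0 <= c *+ 2 by rewrite mulrn_wge0// ltW.
have := @Lp_norm2Z _ _ Omega (fun x => h^-1 * (S h u x - u x)) h (c *+ 2) mO.
move=> /(_ mq' (ltW h0) c20 q2).
rewrite (_ : (fun x => h * _) = (fun x => S h u x - u x)); last first.
  by apply/funext => x; rewrite mulrA divff ?gt_eqF// mul1r.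
move=> dh.
have hc0 : 0 <= h * (c *+ 2) by rewrite mulr_ge0// ltW.
have ht : n.+1%:R * h = t by rewrite /h mulrA divff ?mul1r.
have := @heat_deviation_mul u h (h * (c *+ 2)) n h0 hc0 Lu dh.
by rewrite ht (mulrA _ h) ht.
Qed.

Lemma heat_op_ge0 u t x : 0 < t -> Omega x -> (forall y, Omega y -> 0 <= u y) ->
  0 <= heat_op Omega k t u x.
Proof.
move=> t0 Ox u0; apply: Rintegral_ge0 => y Oy.
by rewrite mulr_ge0 ?u0// ltW// (heat_kernel_gt0 hk).
Qed.

(* The constants come from |Laplacian of bump| <= 30 N / r^2 on a cube of
   volume (2r)^N, and from bump >= 1/8 on a cube of volume (r/N)^N. *)
Lemma heat_bump_lower a r t tau : 0 < t -> t <= tau -> 0 < r -> (0 < N)%N ->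
  cube a r `<=` Omega ->
  3600 * 128 * tau ^+ 2 * N%:R ^+ 2 * (N%:R *+ 2) ^+ N <= r ^+ 4 ->
  (((256%:R)^-1 * (r / N%:R) ^+ N)%:E <=
    \int[leb]_(x in cube a r) (S t (bump a r) x)%:E)%E.
Proof.
move=> t0 tt r0 N0 cO big.
pose u := bump a r; pose v := S t u; pose E := cube a r.
pose f x := \sum_i ddbump a r i i x.
pose M : R := N%:R * (30 * r ^- 2).
have mE : measurable E := measurable_cube a r.
have NR : (0 : R) < N%:R by rewrite ltr0n.
have M0 : 0 < M by rewrite !mulr_gt0// invr_gt0 exprn_gt0.
have fM x : `|f x| <= M.
  rewrite (le_trans (ler_norm_sum _ _ _))//.
  rewrite (le_trans (ler_sum _ (fun i _ => ddbump_le a i x r0)))//.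
  by rewrite sumr_const card_ord -[leLHS]mulr_natl.
have f0 x : ~ E x -> f x = 0.
  by move=> xE; rewrite /f big1// => i _; exact: ddbump_eq0.
have mf : measurable_fun Omega f.
  apply: measurable_sum => i; apply: measurable_funTS.
  by apply: continuous_measurable_rV; exact: ddbump_continuous.
have Lf := in_Lp2_bounded mO mf (ltW r0) (ltW M0) fM f0.
have nf := Lp_norm2_bounded mO mf (ltW r0) (ltW M0) fM f0.
have Lu : in_Lp Omega 2%:E u := in_Lp2_bump oO a r0.
have Lv := in_Lp2_heat t0 Lu.
have c0 : 0 < M * Num.sqrt ((r *+ 2) ^+ N).
  by rewrite mulr_gt0// sqrtr_gt0 exprn_gt0// mulrn_wgt0.
have dev := heat_deviation_generator t0 c0 Lu Lf (laplacian_bump theta oO r0 cO) nf.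
have D0 : 0 <= t * (M * Num.sqrt ((r *+ 2) ^+ N) *+ 2).
  by rewrite mulr_ge0 ?mulrn_wge0// ltW.
move/(Lp_norm2_leP _ _ D0) : dev.
set D2 := _ ^+ 2 => dev.
have rN0 : 0 < (r / N%:R) ^+ N by rewrite exprn_gt0// divr_gt0.
(* [D2] is the square of 2t times 30 N r^-2 times the square root of (2r)^N, whence 3600 = (2 *
   30)^2. Since (2r)^N = (2N)^N (r/N)^N, the hypothesis on r^4 leaves the factor 1/128. *)
have D2le : D2 <= (1 / 128) * (r / N%:R) ^+ N.
  have -> : D2 = (3600 * t ^+ 2 * N%:R ^+ 2 * (N%:R *+ 2) ^+ N) / r ^+ 4 *
      (r / N%:R) ^+ N.
    have sq : Num.sqrt ((r *+ 2) ^+ N) ^+ 2 = (N%:R *+ 2) ^+ N * (r / N%:R) ^+ N.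
      rewrite sqr_sqrtr ?exprn_ge0 ?mulrn_wge0 ?ltW// -exprMn.
      by congr (_ ^+ _); field; rewrite gt_eqF.
    rewrite /D2 -[_ *+ 2]mulr_natl mulrA mulrA exprMn sq /M.
    move: ((N%:R *+ 2) ^+ N) ((r / N%:R) ^+ N) => B C; field.
    by rewrite gt_eqF.
  rewrite ler_pM2r// ler_pdivrMr ?exprn_gt0//.
  have : t ^+ 2 <= tau ^+ 2 by rewrite lerXn2r// nnegrE ltW// (lt_le_trans t0).
  set B := (N%:R *+ 2) ^+ N in big *.
  have NB0 : 0 <= N%:R ^+ 2 * B.
    by rewrite mulr_ge0 ?sqr_ge0// exprn_ge0// mulrn_wge0// ltW.
  move=> /(ler_wpM2r NB0) h.
  have e1 : 3600 * t ^+ 2 * N%:R ^+ 2 * B = 3600 * (t ^+ 2 * (N%:R ^+ 2 * B)) by ring.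
  have e2 : 3600 * 128 * tau ^+ 2 * N%:R ^+ 2 * B =
    3600 * 128 * (tau ^+ 2 * (N%:R ^+ 2 * B)) by ring.
  rewrite e1; rewrite e2 in big; lra.
have mv : measurable_fun E v by apply: measurable_funS cO _ => //; case: Lv.
have md : measurable_fun E (fun x => v x - u x).
  by apply: measurable_funS cO _ => //; case: (in_Lp2B Lv Lu).
have v0 x : E x -> 0 <= v x.
  by move=> Ex; apply: heat_op_ge0 => // [|y _]; [exact: cO|exact: bump_ge0].
(* Since v >= 0 and 0 <= u <= 1, u^2 <= 2 v + (v - u)^2 pointwise on E. *)
have main : (((1 / 8) ^+ 2 * (r / N%:R) ^+ N)%:E <=
    2%:E * (\int[leb]_(x in E) (v x)%:E) + D2%:E)%E.
  apply: (le_trans (bump_power_ge 2 a r0)).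
  apply: (@le_trans _ _ (\int[leb]_(x in E) (2%:E * (v x)%:E +
     ((v x - u x) ^+ 2)%:E))%E).
    apply: ge0_le_integral => //.
    - by move=> x _; rewrite lee_fin sqr_ge0.
    - apply/measurable_EFinP; apply: measurable_funX; apply: measurable_funTS.
      by apply: continuous_measurable_rV; exact: bump_continuous.
    - apply: emeasurable_funD; last first.
        by apply/measurable_EFinP; exact: measurable_funX.
      by apply/measurable_EFinP; exact: measurable_funM.
    - move=> x Ex; rewrite -EFinM -EFinD lee_fin -/u.
      have u1 : u x <= 1 := bump_le1 a r x.
      have := v0 _ Ex; have := sqr_ge0 (v x) => h1 h2.
      have : u x * v x <= v x by rewrite ler_piMl.
      have -> : (v x - u x) ^+ 2 = v x ^+ 2 - 2 * (u x * v x) + u x ^+ 2 by ring.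
      lra.
  rewrite ge0_integralD//; last 4 first.
  - by move=> x Ex; rewrite mule_ge0// lee_fin v0.
  - by apply/measurable_EFinP; exact: measurable_funM.
  - by move=> x _; rewrite lee_fin sqr_ge0.
  - by apply/measurable_EFinP; exact: measurable_funX.
  have mEv : measurable_fun E (fun x => (v x)%:E) by exact/measurable_EFinP.
  rewrite (ge0_integralZl _ mE mEv) => [|x Ex|//]; last by rewrite lee_fin v0.
  apply: leeD => //; apply: le_trans dev; apply: ge0_subset_integral => //.
  - apply/measurable_EFinP; apply: measurable_funX.
    by case: (in_Lp2B Lv Lu).
  - by move=> x _; rewrite lee_fin sqr_ge0.
have I0 : (0 <= \int[leb]_(x in E) (v x)%:E)%E.
  by apply: integral_ge0 => x Ex; rewrite lee_fin v0.
(* With X = (r/N)^N and I the integral of [v], the bounds X/64 <= 2 I + D2 and D2 <= X/128 give I >=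
   X/256. An infinite I is immediate. *)
move: main I0; rewrite -/u -/v -/E.
case: (\int[leb]_(x in E) (v x)%:E)%E => [I||]//; last by move=> _ _; rewrite leey.
rewrite -EFinM -EFinD !lee_fin (_ : (1 / 8) ^+ 2 = 1 / 64); last by field.
by move: D2 ((r / N%:R) ^+ N) D2le {dev rN0} => D X; lra.
Qed.

End heat_semigroup.

(** * Bumps far from the hole *)

Section gaussian_tail.
Context (R : realType) (N : nat).
Local Notation V := 'rV[R]_N.
Local Notation leb := (lebesgue_rV R N).

Lemma gaussianE (x : V) (t : R) : gaussian x t =
  expR (- ((\sum_(i < N) x ord0 i ^+ 2) / (4 * t))) / (4 * pi * t) `^ (N%:R / 2).
Proof.
rewrite /gaussian /enorm sqr_sqrtr//.
by apply: sumr_ge0 => i _; exact: sqr_ge0.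
Qed.

Lemma gaussian_ge0 (x : V) (t : R) : 0 <= gaussian x t.
Proof. by rewrite divr_ge0// ?expR_ge0// powR_ge0. Qed.

Lemma measurable_gaussian (t : R) : measurable_fun [set: V] (fun x => gaussian x t).
Proof.
under eq_fun do rewrite gaussianE.
apply: measurable_funM => //; apply: measurableT_comp => //.
apply: measurableT_comp => //; apply: measurable_funM => //.
by apply: measurable_sum => i; apply: measurable_funX; exact: measurable_rV_coord.
Qed.

(** For t >= 1 the normalizing factor is at least 1. The exponential is bounded through exp(-y) <= 1
    / (1 + y), with y bounded below by the square of a single coordinate. This rational bound allows
    an explicit choice of the distance [d]. *)
Lemma gaussian_le (x : V) i (t tau d : R) : 1 <= t -> t <= tau ->
  0 <= d -> d <= x ord0 i -> gaussian x t <= (1 + d ^+ 2 / (4 * tau))^-1.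
Proof.
move=> t1 tt d0 dx; rewrite gaussianE.
have t0 : 0 < t by rewrite (lt_le_trans ltr01).
have tau0 : 0 < tau by rewrite (lt_le_trans t0).
have b1 : 1 <= 4 * pi * t :> R.
  by have p2 := pi_ge2 R; rewrite -[leLHS]mul1r; apply: ler_pM => //; lra.
have p1 : 1 <= (4 * pi * t) `^ (N%:R / 2).
  by rewrite -[leLHS](powRr0 (4 * pi * t)); apply: ler_powR => //; rewrite divr_ge0.
rewrite ler_pdivrMr ?(lt_le_trans ltr01)//.
have h0 : 0 < 1 + d ^+ 2 / (4 * tau).
  by rewrite ltr_wpDr// divr_ge0 ?sqr_ge0// mulr_ge0// ltW.
rewrite -[leLHS]mulr1; apply: ler_pM => //.
rewrite expRN lef_pV2 ?posrE ?expR_gt0//.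
apply: le_trans (expR_ge1Dx _); rewrite lerD2l.
apply: ler_pM; rewrite ?sqr_ge0 ?invr_ge0 ?mulr_ge0//; first exact: ltW.
  rewrite (bigD1 i)//= ler_wpDr ?sumr_ge0//; first by move=> j _; exact: sqr_ge0.
  by rewrite lerXn2r ?nnegrE// (le_trans d0).
by rewrite lef_pV2 ?posrE ?mulr_gt0// ler_pM2l.
Qed.

End gaussian_tail.

Section far_bump.
Context (R : realType) (N : nat) (N0 : (0 < N)%N).
Local Notation V := 'rV[R]_N.
Local Notation leb := (lebesgue_rV R N).
Context (C : set V) (cC : compact C).
Local Notation Omega := (~` C).
Context (theta : V -> R) (k : V -> V -> R -> R) (hk : is_heat_kernel Omega theta k).
Local Notation S := (heat_op Omega k).

Let oO : open Omega.
Proof. by rewrite openC; apply: compact_closed => //; exact: norm_hausdorff. Qed.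

(* (1/256) (r/N)^N / (2r)^N: the fraction of the mass of a wide bump that stays
   in its support. *)
Definition retention : R := (256 * (N%:R *+ 2) ^+ N)^-1.

Lemma retention_gt0 : 0 < retention.
Proof. by rewrite invr_gt0 mulr_gt0// exprn_gt0// mulrn_wgt0// ltr0n. Qed.

(** The width [r] is fixed first, from [tau] and the dimension. The mass and retention estimates
    then hold for every centre with the cube in [Omega], so the centre can be pushed along the
    diagonal until the cube misses the hole and carries little Gaussian mass. *)
Lemma far_bump (tau eps : R) : 1 <= tau -> 0 < eps ->
  exists (a : V) (r : R), [/\ 0 < r, cube a r `<=` Omega, 1 <= bump_mass Omega a r,
    (forall t, 0 < t -> t <= tau ->
      ((retention * bump_mass Omega a r)%:E <=
        \int[leb]_(x in cube a r) (S t (bump a r) x)%:E)%E) &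
    (forall t, 1 <= t -> t <= tau ->
      (\int[leb]_(x in cube a r) (gaussian x t)%:E <= eps%:E)%E)].
Proof.
move=> tau1 eps0; pose i0 := Ordinal N0.
have NR1 : 1 <= N%:R :> R by rewrite ler1n.
have NR : 0 < N%:R :> R by rewrite ltr0n.
have tau0 : 0 < tau by rewrite (lt_le_trans ltr01).
have [M CM] : exists M : R, forall x, C x -> `|x ord0 i0| <= M.
  have : compact ((fun x : V => x ord0 i0) @` C).
    apply: continuous_compact => //; apply: continuous_subspaceT => x.
    exact: coord_continuous.
  move=> /compact_bounded [M [_ /(_ (`|M| + 1))]].
  rewrite (le_lt_trans (ler_norm _)) ?ltrDl// => /(_ isT) /= hM.
  by exists (`|M| + 1) => x Cx; apply: hM; exists x.
pose A : R := 3600 * 128 * tau ^+ 2 * N%:R ^+ 2 * (N%:R *+ 2) ^+ N.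
have A0 : 0 <= A.
  apply: mulr_ge0; last by rewrite exprn_ge0// mulrn_wge0.
  apply: mulr_ge0; last exact: sqr_ge0.
  apply: mulr_ge0; last exact: sqr_ge0.
  by apply: mulr_ge0; exact: ler0n.
(* The term 8N gives r/N >= 8, which offsets the factor 1/8 in the mass bound. The term [A] gives A
   <= r <= r^4, since r >= 1. *)
pose r : R := 8 * N%:R + A.
have r8 : 8 * N%:R <= r by rewrite lerDl.
have r0 : 0 < r by rewrite (lt_le_trans _ r8)// mulr_gt0.
have rA : A <= r ^+ 4.
  have r1 : 1 <= r by rewrite (le_trans _ r8)//; lra.
  apply: (@le_trans _ _ r); first by rewrite lerDr mulr_ge0// ltW.
  by rewrite -[leLHS]expr1 ler_weXn2l.
(* Once d^2 >= B, the volume (2r)^N divided by 1 + d^2 / (4 tau) is at most [eps]. Below, |M| + 1 in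
   [d] clears the hole and gives d >= 1, hence d^2 >= d >= B. *)
pose B : R := 4 * tau * ((r *+ 2) ^+ N / eps).
have B0 : 0 <= B.
  apply: mulr_ge0; first by rewrite mulr_ge0// ltW.
  by apply: divr_ge0; [rewrite exprn_ge0// mulrn_wge0//|]; exact: ltW.
pose d : R := `|M| + 1 + B.
pose a : V := const_mx (d + r).
have d0 : 0 <= d by apply: addr_ge0 => //; exact: addr_ge0.
have ax x : cube a r x -> d <= x ord0 i0.
  by move=> /(_ i0); rewrite mxE ler_distl => /andP[]; rewrite addrK.
have cO : cube a r `<=` Omega.
  move=> x /ax dx Cx; have := CM _ Cx; apply/negP; rewrite -ltNge.
  apply: lt_le_trans (ler_norm _); apply: lt_le_trans dx.
  by rewrite /d -addrA (le_lt_trans (ler_norm _))// ltrDl ltr_pwDl.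
have mO := open_measurable_rV oO.
have rN : (r *+ 2) ^+ N = (N%:R *+ 2) ^+ N * (r / N%:R) ^+ N.
  by rewrite -exprMn; congr (_ ^+ _); field; rewrite gt_eqF.
exists a, r; split => //.
- rewrite -lee_fin bump_massE//.
  apply: (@le_trans _ _ (\int[leb]_(x in cube a r) (bump a r x ^+ 1)%:E)%E).
    apply: le_trans (bump_power_ge 1 a r0).
    rewrite expr1 lee_fin; apply: (@le_trans _ _ (1 / 8 * 8)); first by lra.
    rewrite ler_pM2l; last by lra.
    have r8N : 8 <= r / N%:R by rewrite ler_pdivlMr.
    apply: (le_trans r8N); rewrite -[leLHS]expr1 ler_weXn2l//.
    by apply: le_trans r8N; lra.
  under eq_integral do rewrite expr1.
  apply: ge0_subset_integral => //; first exact: measurable_cube.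
    by apply/measurable_EFinP; exact: measurable_bump.
  by move=> x _; rewrite lee_fin bump_ge0.
- move=> t t0 tt; apply: le_trans (heat_bump_lower oO hk t0 tt r0 N0 cO rA).
  rewrite lee_fin.
  apply: (@le_trans _ _ (retention * (r *+ 2) ^+ N)).
    by rewrite ler_pM2l ?retention_gt0// (bump_mass_le oO).
  have X0 : 0 < (N%:R *+ 2) ^+ N :> R by rewrite exprn_gt0// mulrn_wgt0.
  rewrite rN /retention; move: ((N%:R *+ 2) ^+ N) X0 ((r / N%:R) ^+ N) => X X0 Y.
  by rewrite le_eqVlt; apply/orP; left; apply/eqP; field; rewrite gt_eqF.
- move=> t t1 tt.
  apply: (@le_trans _ _ (\int[leb]_(x in cube a r) ((1 + d ^+ 2 / (4 * tau))^-1)%:E)%E).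
    apply: ge0_le_integral => //.
    + exact: measurable_cube.
    + by move=> x _; rewrite lee_fin gaussian_ge0.
    + by apply/measurable_EFinP; apply: measurable_funTS; exact: measurable_gaussian.
    + by move=> x xc; rewrite lee_fin (gaussian_le (i := i0))//; exact: ax.
  rewrite integral_cst//; last exact: measurable_cube.
  rewrite [X in (_ * X)%E](lebesgue_rV_cube a (ltW r0)) -EFinM lee_fin.
  have h0 : 0 < 1 + d ^+ 2 / (4 * tau).
    by rewrite ltr_wpDr// divr_ge0 ?sqr_ge0// mulr_ge0// ltW.
  rewrite ler_pdivrMl// mulrC -ler_pdivrMl// mulrC.
  have d1 : 1 <= d by rewrite /d -addrA addrCA lerDl addr_ge0.
  have Bd : B <= d by rewrite lerDr addr_ge0.
  have : B <= d ^+ 2 by rewrite (le_trans Bd)// expr2 ler_peMl.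
  have -> : (r *+ 2) ^+ N / eps = B / (4 * tau).
    by rewrite /B mulrAC divff ?mul1r// mulf_neq0// gt_eqF.
  move=> Bd2; rewrite ler_wpDl// ler_pM2r// invr_gt0 mulr_gt0//.
Qed.

End far_bump.

(** * Superposition of bumps *)

Section superposition.
Context d (T : measurableType d) (R : realType) (mu : {measure set T -> \bar R}).
Context (D : set T) (mD : measurable D) (w : nat -> T -> R).
Context (w0 : forall n x, 0 <= w n x) (w1 : forall n x, w n x <= 1).
Context (mw : forall n, measurable_fun D (w n)).
Context (iw : forall n, (\int[mu]_(x in D) (w n x)%:E = 1)%E).

Definition dyadic n : R := 1 / (2 ^ n.+1)%:R.

Lemma dyadic_gt0 n : 0 < dyadic n.
Proof. by rewrite divr_gt0// ltr0n expn_gt0. Qed.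

Lemma dyadic_sum : (\sum_(0 <= n <oo) (dyadic n)%:E = 1)%E.
Proof.
have /cvg_lim := @cvg_geometric_eseries_half R 1 0.
rewrite expr0 divr1 => <-//; congr (limn _); apply/funext => n.
by apply: eq_bigr => i _; rewrite /dyadic addn1.
Qed.

(** The series is summed in the extended reals, where nonnegative terms always have a sum. It is
    finite because 0 <= w <= 1 and the weights add up to 1. *)
Definition superposition x : R := fine (\sum_(0 <= n <oo) (dyadic n * w n x)%:E)%E.

Lemma superpositionE x :
  ((superposition x)%:E = \sum_(0 <= n <oo) (dyadic n * w n x)%:E)%E.
Proof.
rewrite fineK// ge0_fin_numE; last first.
  by apply: nneseries_ge0 => n _ _; rewrite lee_fin mulr_ge0// ltW// dyadic_gt0.
apply: (@le_lt_trans _ _ (\sum_(0 <= n <oo) (dyadic n)%:E)%E).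
  apply: lee_nneseries => [n _ _|n _].
    by rewrite lee_fin mulr_ge0// ltW// dyadic_gt0.
  by rewrite lee_fin ler_piMr// ltW// dyadic_gt0.
by rewrite dyadic_sum ltry.
Qed.

Lemma superposition_ge n x : dyadic n * w n x <= superposition x.
Proof.
have h m : (0 <= (dyadic m * w m x)%:E)%E.
  by rewrite lee_fin mulr_ge0// ltW// dyadic_gt0.
rewrite -lee_fin superpositionE; apply: (@le_trans _ _ (\sum_(0 <= m < n.+1) (dyadic m * w m x)%:E)%E).
  by rewrite big_nat_recr//= leeDr// sume_ge0.
exact: nneseries_lim_ge.
Qed.

Lemma superposition_ge0 x : 0 <= superposition x.
Proof.
by apply: le_trans (superposition_ge 0 x); rewrite mulr_ge0// ltW// dyadic_gt0.
Qed.

Let mterm n : measurable_fun D (fun x => (dyadic n * w n x)%:E).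
Proof. by apply/measurable_EFinP; exact: measurable_funM. Qed.

Let term0 n x : (0 <= (dyadic n * w n x)%:E)%E.
Proof. by rewrite lee_fin mulr_ge0// ltW// dyadic_gt0. Qed.

Lemma measurable_superposition : measurable_fun D superposition.
Proof.
apply/measurable_EFinP; rewrite (_ : EFin \o _ =
  (fun x => \sum_(0 <= n <oo | n \in predT) (dyadic n * w n x)%:E)%E); last first.
  by apply/funext => x; exact: superpositionE.
by apply: ge0_emeasurable_sum => // n x _ _; exact: term0.
Qed.

Lemma integral_superposition : (\int[mu]_(x in D) (superposition x)%:E = 1)%E.
Proof.
under eq_integral do rewrite superpositionE.
rewrite (integral_nneseries _ mD mterm); last by move=> n x _; exact: term0.
rewrite -dyadic_sum; apply: eq_eseriesr => n _.
under eq_integral do rewrite EFinM.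
rewrite ge0_integralZl//.
- by rewrite iw mule1.
- exact/measurable_EFinP.
- by move=> x _; rewrite lee_fin.
- by rewrite lee_fin ltW// dyadic_gt0.
Qed.

End superposition.

(** * The lower bound *)

Section lower_bound.
Context (R : realType) (N : nat).
Local Notation V := 'rV[R]_N.
Local Notation leb := (lebesgue_rV R N).
Context (Omega : set V) (oO : open Omega).

Let mO : measurable Omega := open_measurable_rV oO.

Lemma Lp_norm1E (f : V -> R) : Lp_norm Omega 1%:E f = (\int[leb]_(x in Omega) `|f x|%:E)%E.
Proof.
rewrite /Lp_norm Lnorm1 EFin_patch [RHS]integral_mkcond; apply: eq_integral => x _.
by rewrite /patch /=; case: ifP => //; rewrite normr0.
Qed.

(** The norm is at least its part over [E], where |f| <= |f - m G| + |m| G is integrated. *)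
Lemma Lp_norm1_lower (E : set V) (f G : V -> R) (m c e : R) :
  measurable E -> E `<=` Omega -> measurable_fun Omega f ->
  measurable_fun Omega G -> (forall x, 0 <= G x) ->
  (c%:E <= \int[leb]_(x in E) `|f x|%:E)%E ->
  (\int[leb]_(x in E) (G x)%:E <= e%:E)%E ->
  ((c - `|m| * e)%:E <= Lp_norm Omega 1%:E (fun x => f x - m * G x)%R)%E.
Proof.
move=> mE EO mf mG G0 cf Ge.
have mfE := measurable_funS mO EO mf; have mGE := measurable_funS mO EO mG.
have mEG : measurable_fun E (EFin \o G) by exact/measurable_EFinP.
have md : measurable_fun Omega (fun x => `|f x - m * G x|%:E).
  apply/measurable_EFinP; apply: measurableT_comp => //.
  by apply: measurable_funB => //; exact: measurable_funM.
apply: (@le_trans _ _ (\int[leb]_(x in E) `|f x - m * G x|%:E)%E); last first.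
  rewrite Lp_norm1E; apply: ge0_subset_integral => //.
have mdE := measurable_funS mO EO md.
rewrite EFinB leeBlDr//; apply: (le_trans cf).
apply: (@le_trans _ _ (\int[leb]_(x in E) (`|f x - m * G x|%:E + `|m|%:E * (G x)%:E))%E).
  apply: ge0_le_integral => //.
  - by apply/measurable_EFinP; exact: measurableT_comp.
  - by apply: emeasurable_funD => //; exact: measurable_funeM.
  - move=> x _; rewrite -EFinM -EFinD lee_fin.
    rewrite -{2}(ger0_norm (G0 x)) -normrM.
    by rewrite -{1}(subrK (m * G x) (f x)) ler_normD.
rewrite ge0_integralD//; last 2 first.
- by move=> x _; rewrite mule_ge0// lee_fin.
- exact: measurable_funeM.
apply: leeD => //.
rewrite (ge0_integralZl _ mE mEG) => [|x _|]; rewrite ?lee_fin//.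
by rewrite EFinM; apply: lee_wpmul2l; rewrite ?lee_fin.
Qed.

Context (theta : V -> R) (k : V -> V -> R -> R) (hk : is_heat_kernel Omega theta k).

(** Positivity of the kernel gives the comparison wherever both integrals converge absolutely.
    Applied to a single bump below the superposition, it avoids passing the series through the
    semigroup. *)
Lemma heat_op_scaled_le (u v : V -> R) (c t : R) : 0 < t ->
  in_Lp Omega 1%:E u -> in_Lp Omega 1%:E v ->
  (forall x, Omega x -> c * u x <= v x) ->
  {ae leb, forall x, Omega x -> c * heat_op Omega k t u x <= heat_op Omega k t v x}.
Proof.
move=> t0 Lu Lv cuv.
have := heat_kernel_integrable hk (lexx _) Lu t0.
have := heat_kernel_integrable hk (lexx _) Lv t0.
apply: filterS2 => x iv iu Ox; rewrite -RintegralZl//; last exact: iu.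
apply: le_Rintegral => //.
- have := integrableZl mO c (iu Ox); apply: eq_integrable => // y _.
- exact: iv.
- move=> y Oy; rewrite mulrCA ler_wpM2l ?cuv//.
  by rewrite ltW// (heat_kernel_gt0 hk).
Qed.

End lower_bound.

Theorem theorem3p6 (R : realType) (N : nat) (hN : (0 < N)%N)
    (C : set 'rV[R]_N) (hC : is_hole C)
    (Omega : set 'rV[R]_N) (hOmega : Omega = ~` C)
    (theta : 'rV[R]_N -> R) (htheta : is_boundary_function Omega theta)
    (k : 'rV[R]_N -> 'rV[R]_N -> R -> R) (hk : is_heat_kernel Omega theta k)
    (Phi : 'rV[R]_N -> R) (hPhi : asymptotic_profile Omega k Phi)
    (g : R -> R)
    (g_range : forall t, 0 <= t -> 0 < g t <= 1)
    (g_decr : forall s t, 0 <= s -> s <= t -> g t <= g s)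
    (g_cont : {within `[0, +oo[, continuous g})
    (g_lim : g t @[t --> +oo] --> 0) :
  exists u0 : 'rV[R]_N -> R,
    [/\ forall x, Omega x -> 0 <= u0 x,
        in_Lp Omega 1%:E u0,
        Lp_norm Omega 1%:E u0 = 1%E &
        exists2 T : R, 0 < T & forall t, T < t ->
          ((g t)%:E <= Lp_norm Omega 1%:E (fun x =>
             heat_op Omega k t u0 x
             - asymptotic_mass Omega Phi u0 * gaussian x t)%R)%E].
Proof.
have [cC _ _ _] := hC; subst Omega; set Omega := ~` C in hk *.
have oO : open Omega.
  by rewrite openC; apply: compact_closed => //; exact: norm_hausdorff.
have mO := open_measurable_rV oO.
pose c0 := retention R N; have c00 : 0 < c0 by exact: retention_gt0.
(* Half of what the n-th bump keeps in its cube: one half will dominate [g], the other absorbs the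
   Gaussian term. *)
pose e n := dyadic R n * c0 / 2.
have e0 n : 0 < e n by rewrite !mulr_gt0 ?dyadic_gt0// invr_gt0.
(* The bound n+1 <= s n makes the times unbounded and at least 1. *)
have /choice[s hs] n : exists s : R, n.+1%:R <= s /\ forall t, s <= t -> g t <= e n.
  have /cvgrPdist_lt /(_ _ (e0 n)) [M [_ hM]] := g_lim.
  exists (Num.max n.+1%:R (M + 1)); split; first by rewrite le_max lexx.
  move=> t; rewrite ge_max => /andP[_ Mt].
  have /hM : M < t by rewrite (lt_le_trans _ Mt)// ltrDl.
  by rewrite /= sub0r normrN => h; rewrite (le_trans (ler_norm _))// ltW.
have s1 n : 1 <= s n by rewrite (le_trans _ (hs n).1)// ler1n.
(* [p n] holds the centre and half-side of the n-th cube, in charge of times up to [s n.+1]. The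
   mass [m] depends on all the bumps and is known only afterwards, so the Gaussian error carries a
   divisor n+1 that eventually exceeds |m|. *)
have /choice[p hp] n : exists p : 'rV[R]_N * R, [/\ 0 < p.2, cube p.1 p.2 `<=` Omega,
    1 <= bump_mass Omega p.1 p.2,
    (forall t, 0 < t -> t <= s n.+1 ->
      ((c0 * bump_mass Omega p.1 p.2)%:E <=
        \int[lebesgue_rV R N]_(x in cube p.1 p.2)
          (heat_op Omega k t (bump p.1 p.2) x)%:E)%E) &
    (forall t, 1 <= t -> t <= s n.+1 ->
      (\int[lebesgue_rV R N]_(x in cube p.1 p.2) (gaussian x t)%:E
        <= (e n / n.+1%:R)%:E)%E)].
  have en0 : 0 < e n / n.+1%:R by rewrite divr_gt0.
  have [a [r har]] := far_bump hN cC hk (s1 n.+1) en0.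
  by exists (a, r).
pose b n := bump (p n).1 (p n).2.
pose Z n := bump_mass Omega (p n).1 (p n).2.
have Z1 n : 1 <= Z n by case: (hp n).
have Z0 n : 0 < Z n by rewrite (lt_le_trans ltr01).
have r0 n : 0 < (p n).2 by case: (hp n).
(* Normalized in L^1; since Z n >= 1, the bound by 1 needed for the superposition is preserved. *)
pose w n x := (Z n)^-1 * b n x.
have w0 n x : 0 <= w n x by rewrite mulr_ge0 ?invr_ge0 ?bump_ge0// ltW.
have w1 n x : w n x <= 1.
  by rewrite mulr_ile1 ?invr_ge0 ?bump_ge0 ?bump_le1 ?invf_le1// ltW.
have Lb n : in_Lp Omega 1%:E (b n) by exact: (in_Lp1_bump oO _ (r0 n)).
have mb n : measurable_fun Omega (b n) by case: (Lb n).
have mw n : measurable_fun Omega (w n) by exact: measurable_funM.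
have iw n : (\int[lebesgue_rV R N]_(x in Omega) (w n x)%:E = 1)%E.
  under eq_integral do rewrite EFinM.
  rewrite ge0_integralZl//.
  - by rewrite -bump_massE// -EFinM mulVf// gt_eqF.
  - exact/measurable_EFinP.
  - by move=> x _; rewrite lee_fin bump_ge0.
  - by rewrite lee_fin invr_ge0 ltW.
pose u0 := superposition w.
have u00 x : 0 <= u0 x by exact: superposition_ge0.
have mu0 : measurable_fun Omega u0 by exact: measurable_superposition.
have nu0 : Lp_norm Omega 1%:E u0 = 1%E.
  rewrite Lp_norm1E//; under eq_integral do rewrite ger0_norm//.
  exact: integral_superposition.
have Lu0 : in_Lp Omega 1%:E u0 by split => //; rewrite nu0 ltry.
exists u0; split => //.
set m := asymptotic_mass _ _ _.
(* No bound on [m] is needed: the Gaussian errors [e n / n.+1] beat it. *)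
pose n0 := Num.truncn `|m|.
have mn0 : `|m| <= n0.+1%:R by rewrite ltW// truncnS_gt.
exists (s n0) => [|t st]; first by rewrite (lt_le_trans ltr01).
(* Take the least j >= n0 with t <= s j. It differs from [n0] because s n0 < t, and its predecessor
   is the required [n] by minimality. *)
have [n [n0n snt tsn]] : exists n, [/\ (n0 <= n)%N, s n < t & t <= s n.+1].
  have ex : exists j, (n0 <= j)%N && (t <= s j).
    exists (maxn n0 (Num.truncn t)); rewrite leq_maxl /=.
    apply: le_trans (hs _).1; rewrite (le_trans (ltW (truncnS_gt _)))//.
    by rewrite ler_nat ltnS leq_maxr.
  case: (ex_minnP ex) => j /andP[n0j tj] jmin.
  have n0j' : (n0 < j)%N.
    rewrite ltn_neqAle n0j andbT; apply/eqP => n0E.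
    by move: tj; rewrite -n0E leNgt st.
  case: j n0j tj jmin n0j' => // j _ tj jmin n0j; exists j; split => //.
  rewrite ltNge; apply/negP => tsj.
  by have := jmin j; rewrite tsj andbT => /(_ n0j); rewrite ltnn.
have [_ cO _ /(_ t) hheat /(_ t) hgauss] := hp n.
have t1 : 1 <= t by rewrite (le_trans (s1 n))// ltW.
have t0 : 0 < t by rewrite (lt_le_trans ltr01).
have Lheat : in_Lp Omega 1%:E (heat_op Omega k t u0).
  by case: (heat_kernel_contraction hk (lexx _) Lu0 t0).
have mE := measurable_cube (p n).1 (p n).2.
have low : ((dyadic R n * c0)%:E <= \int[lebesgue_rV R N]_(x in cube (p n).1 (p n).2)
    `|heat_op Omega k t u0 x|%:E)%E.
  have Lbt := (heat_kernel_contraction hk (lexx _) (Lb n) t0).1.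
  have mbt : measurable_fun (cube (p n).1 (p n).2) (heat_op Omega k t (b n)).
    by apply: measurable_funS cO _ => //; case: Lbt.
  (* q times the n-th bump is the n-th term of the series, hence lies below [u0]. Its evolution has
     integral at least q c0 Z n = dyadic n c0 over the cube. *)
  pose q := dyadic R n / Z n.
  have q0 : 0 < q by rewrite divr_gt0// dyadic_gt0.
  apply: (@le_trans _ _ (\int[lebesgue_rV R N]_(x in cube (p n).1 (p n).2)
      (q%:E * (heat_op Omega k t (b n) x)%:E))%E).
    rewrite (ge0_integralZl _ mE) //; last 3 first.
    - exact/measurable_EFinP.
    - move=> x Ex; rewrite lee_fin; apply: (heat_op_ge0 hk t0 (cO _ Ex)) => y _.
      exact: bump_ge0.
    - by rewrite lee_fin ltW.
    rewrite (_ : dyadic R n * c0 = q * (c0 * Z n)); last first.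
      by rewrite /q; field; rewrite gt_eqF.
    by rewrite EFinM; apply: lee_wpmul2l; [rewrite lee_fin ltW|exact: hheat].
  apply: ae_ge0_le_integral => //.
  - move=> x Ex; apply: mule_ge0; rewrite lee_fin; first exact: ltW.
    by apply: (heat_op_ge0 hk t0 (cO _ Ex)) => y _; exact: bump_ge0.
  - by apply: measurable_funeM; exact/measurable_EFinP.
  - apply/measurable_EFinP; apply: measurableT_comp => //.
    by apply: measurable_funS cO _ => //; case: Lheat.
  have ql x : Omega x -> q * b n x <= u0 x.
    by move=> _; rewrite /q -mulrA; exact: superposition_ge.
  have := heat_op_scaled_le oO hk t0 (Lb n) Lu0 ql.
  apply: filterS => x h Ex; rewrite -EFinM lee_fin.
  by apply: le_trans (ler_norm _); apply: h; exact: cO.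
have := Lp_norm1_lower oO m mE cO Lheat.1
  (measurable_funTS (@measurable_gaussian R N t)) (fun x => gaussian_ge0 x t) low (hgauss t1 tsn).
apply: le_trans; rewrite lee_fin (le_trans ((hs n).2 t (ltW snt)))//.
(* Of the two copies of [e n], one exceeds |m| e n / (n+1) because |m| <= n0 + 1 <= n + 1; the other
   bounds g(t) because s n < t. *)
have -> : dyadic R n * c0 = e n + e n by rewrite /e; field.
rewrite lerBrDr lerD2l mulrCA ler_piMr ?(ltW (e0 n))// ler_pdivrMr// mul1r.
by rewrite (le_trans mn0)// ler_nat.
Qed.
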